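(* Let $x_0>0$, $a>0$, $b>0$, $\sigma>0$ with $2a\ge\sigma^2$, and let $X=\{X_t,t\ge0\}$ be the unique non-negative strong solution of $$X_t = x_0 + \int_0^t (a - b X_s)\,ds + \sigma \int_0^t \sqrt{X_s}\,dW_s,\qquad t\ge0.$$ Then for all $t\ge0$, $$\mathbf E \sup_{s\le t} \left(X_s + b \int_0^s X_u\, du \right)^2 \le 2(x_0 + a t)^2 + \frac{8\sigma^2}{b} \left(x_0 -\frac{a}{b}\right)\left(1 - e^{-b t}\right) + \frac{8\sigma^2 a}{b}\, t.$$
   Context: $W=\{W_t,t\ge0\}$ is a Wiener process on a probability space $(\Omega,\mathcal F,\mathbf P)$ and $\mathbf E$ is expectation with respect to $\mathbf P$. The equation is known to have a unique non-negative strong solution (the Cox--Ingersoll--Ross process). *)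

(* Defs.v *)
From HB Require Import structures.
From mathcomp Require Import all_boot all_order all_algebra.
From mathcomp Require Import all_classical all_reals all_analysis.
Import Order.TTheory GRing.Theory Num.Theory numFieldNormedType.Exports.

Set Implicit Arguments.
Unset Strict Implicit.
Unset Printing Implicit Defensive.

Local Open Scope classical_set_scope.
Local Open Scope ring_scope.

(** Real-valued processes indexed by time [t >= 0] are functions [R -> T -> R];
    their values at negative times are irrelevant. *)

Section processes.
Context {d : measure_display} {T : measurableType d} {R : realType}.
Variable P : probability T R.
Implicit Types (W X H I : R -> T -> R) (Z : T -> R).

Definition measurable_wrt (G : set (set T)) Z : Prop :=
  forall B : set (measurableTypeR R), measurable B -> G (Z @^-1` B).

Definition adapted (F : R -> set (set T)) X : Prop :=
  forall t : R, 0 <= t -> measurable_wrt (F t) (X t).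

Definition as_continuous X : Prop :=
  {ae P, forall w, {within `[0, +oo[, continuous (fun t : R => X t w)}}.

Definition natural_filtration W (t : R) : set (set T) :=
  <<s [set A | exists (u : R) (B : set (measurableTypeR R)),
         [/\ 0 <= u <= t, measurable B & A = W u @^-1` B]] >>.

Definition augmented_filtration W (t : R) : set (set T) :=
  <<s natural_filtration W t `|` [set A | measurable A /\ P A = 0%E] >>.

Record wiener_process W : Prop := WienerProcess {
  wiener_measurable : forall t : R, 0 <= t -> measurable_fun setT (W t) ;
  wiener_start : {ae P, forall w, W 0 w = 0} ;
  wiener_continuous : as_continuous W ;
  wiener_gaussian : forall (s t : R) (B : set (measurableTypeR R)),
    0 <= s -> s < t -> measurable B ->
    P [set w | B (W t w - W s w)] = normal_prob 0 (Num.sqrt (t - s)) B ;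
  wiener_independent : forall (s t : R) (A : set T) (B : set (measurableTypeR R)),
    0 <= s -> s < t -> natural_filtration W s A -> measurable B ->
    P (A `&` [set w | B (W t w - W s w)]) =
      (P A * P [set w | B (W t w - W s w)%R])%E }.

(** Convergence to 0 in probability. The outer measure induced by [P] agrees
    with [P] on events; it is used because [P] has no meaningful value on
    non-measurable sets, and a process whose paths are only almost surely
    continuous may yield such sets when [P] is not complete. *)
Definition cvg0_in_probability (D : nat -> T -> \bar R) : Prop :=
  forall e : R, 0 < e ->
    mu_ext P [set w | (e%:E <= D k w)%E] @[k --> \oo] --> 0%E.

(** [SimpleProcess n g c] is the process
    [\sum_(i < n) c i * 1_(g i < t <= g i.+1)]. *)
Record simple_process := SimpleProcess {
  simple_size : nat ;
  simple_grid : nat -> R ;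
  simple_coef : nat -> T -> R }.

Definition simple_value (S : simple_process) (t : R) (w : T) : R :=
  \sum_(i < simple_size S)
    simple_coef S i w * \1_(`]simple_grid S i, simple_grid S i.+1]) t.

Definition simple_integral W (S : simple_process) (t : R) (w : T) : R :=
  \sum_(i < simple_size S)
    simple_coef S i w * (W (Num.min t (simple_grid S i.+1)) w
                         - W (Num.min t (simple_grid S i)) w).

Definition simple_wf W (S : simple_process) : Prop :=
  [/\ 0 <= simple_grid S 0,
      {homo simple_grid S : i j / (i <= j)%N >-> i <= j},
      forall i, (i < simple_size S)%N ->
        measurable_wrt (augmented_filtration W (simple_grid S i))
                       (simple_coef S i) &
      exists M : R, forall i w, (i < simple_size S)%N ->
        `|simple_coef S i w| <= M].

(** [Z] is (a version of) the Ito integral of [H] with respect to [W] over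
    [[0, t]]: the limit in probability of the integrals of simple processes
    [S k] such that the integral of [(S k - H) ^+ 2] over [[0, t]] tends to 0
    in probability. This limit does not depend on the choice of [S], and such
    [S] exist for every progressively measurable [H] whose square has almost
    surely a finite integral over [[0, t]]. *)
Definition ito_integral W H (t : R) Z : Prop :=
  exists S : nat -> simple_process,
    [/\ forall k, simple_wf W (S k),
        cvg0_in_probability (fun k w =>
          \int[lebesgue_measure]_(s in `[0%R, t])
            ((simple_value (S k) s w - H s w) ^+ 2)%R%:E)%E &
        cvg0_in_probability (fun k w =>
          (`|simple_integral W (S k) t w - Z w|)%:E)].

Definition ito_integral_process W H I : Prop :=
  [/\ adapted (augmented_filtration W) I, as_continuous I &
      forall t : R, 0 <= t -> ito_integral W H t (I t)].

(** Non-negative strong solutions: [X] is adapted to the augmented filtration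
    of the given [W]. The Lebesgue integral is real-valued. *)
Record cir_solution W (x0 a b sigma : R) X : Prop := CIRSolution {
  cir_adapted : adapted (augmented_filtration W) X ;
  cir_continuous : as_continuous X ;
  cir_ge0 : {ae P, forall w, forall t : R, 0 <= t -> 0 <= X t w} ;
  cir_equation : exists I,
    ito_integral_process W (fun s w => Num.sqrt (X s w)) I /\
    {ae P, forall w, forall t : R, 0 <= t ->
      X t w = x0 + \int[lebesgue_measure]_(s in `[0, t]) (a - b * X s w)
              + sigma * I t w} }.

End processes.

(* Main.v *)
Require Import Defs.
From HB Require Import structures.
From mathcomp Require Import all_boot all_order all_algebra.
From mathcomp Require Import all_classical all_reals all_analysis.
From mathcomp Require Import measurable_realfun measurable_fun_approximation ring lra.
Import Order.TTheory GRing.Theory Num.Theory numFieldNormedType.Exports.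
Import HBSimple HBNNSimple.
Set Implicit Arguments.
Unset Strict Implicit.
Unset Printing Implicit Defensive.
Local Open Scope classical_set_scope.
Local Open Scope ring_scope.

(** Write [Y_t] for the integral of [X] over [[0, t]] and [I_t] for the Ito
    integral, so that [X_t + b Y_t = x0 + a t + sigma I_t] and the claim follows
    from [E sup I^2 <= 4 E Y_t] and a bound on [E Y_t].

    Everything about [I] is read off elementary integrals of simple processes,
    stopped when their bracket exceeds a level [N]: these are martingales along a
    finite grid, bounded in L2, and on finite sets of times they approximate [I]
    in probability, uniformly in the set. As [I] is bounded below (because
    [X >= 0]), letting [N] grow gives [E (x0 + a t + sigma I_t) <= x0 + a t] with
    no a priori integrability. Since [d (e^(b t) Y_t) = e^(b t) (X_t + b Y_t) dt],
    this yields [E Y_t <= (x0 - a/b) (1 - e^(-b t)) / b + a t / b]. Finally a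
    pathwise form of Doob's maximal inequality bounds [I^2] on finite grids, and
    Fatou's lemma along finer and finer grids gives the supremum. *)

(** * Integrable and square integrable random variables *)

(** The definition of the Ito integral gives each time its own approximating simple processes, and
    only a limit in probability, so nothing in it relates the values of [I] at different times. The
    approximating sequence of the final time is therefore shown to work at all earlier times, at a
    rate independent of the finite set of times considered: two simple integrals with close
    integrands differ by a martingale of small bracket, hence, by Doob, by little at all times of a
    grid simultaneously. The second obstacle is measurability. Paths are good only almost surely,
    [P] may be incomplete, and a supremum over all times or a joint measurability of [X] cannot be
    taken for granted. Path properties are therefore asserted off a small measurable event, and
    integrands that may fail to be measurable are dominated by measurable ones. Constants:
    [(u + v)^2 <= 2 u^2 + 2 v^2] separates [x0 + a s] from [sigma I_s], and Doob's factor 4 turns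
    [2 sigma^2] into the [8 sigma^2] that multiplies the bound on [E Y_t]. *)

Section moments.
Context {d : measure_display} {T : measurableType d} {R : realType}.
Variable P : probability T R.
Implicit Types f g v : T -> R.

Definition L1 f := P.-integrable setT (EFin \o f).

Definition L2 f := measurable_fun setT f /\ L1 (fun w => f w ^+ 2).

Lemma L1_measurable f : L1 f -> measurable_fun setT f.
Proof. by move=> /integrableP[/measurable_EFinP]. Qed.

Lemma L1_le f g : measurable_fun setT f -> (forall w, `|f w| <= g w) ->
  L1 g -> L1 f.
Proof.
move=> mf fg; apply: le_integrable => //; first exact/measurable_EFinP.
by move=> w _; rewrite /= lee_fin (le_trans (fg w))// ler_norm.
Qed.

Lemma L1_cst (r : R) : L1 (fun=> r).
Proof.
apply/integrableP; split; first exact/measurable_EFinP.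
by rewrite integral_cst//= probability_setT mule1 ltry.
Qed.

Lemma L1_add f g : L1 f -> L1 g -> L1 (fun w => f w + g w).
Proof.
by move=> /= fi gi; have := @integrableD _ _ _ P _ measurableT _ _ fi gi.
Qed.

Lemma L1_scale r f : L1 f -> L1 (fun w => r * f w).
Proof. by move=> fi; exact: (@integrableZl _ _ _ P _ measurableT _ _ fi). Qed.

Lemma L1_opp f : L1 f -> L1 (fun w => - f w).
Proof.
by move=> /(L1_scale (-1)); under eq_fun do rewrite mulN1r.
Qed.

Lemma L1_sub f g : L1 f -> L1 g -> L1 (fun w => f w - g w).
Proof. by move=> fi /L1_opp gi; exact: L1_add. Qed.

Lemma L1_sum n (F : nat -> T -> R) :
  (forall i, (i < n)%N -> L1 (F i)) -> L1 (fun w => \sum_(i < n) F i w).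
Proof.
elim: n => [|n IH] h.
  by under eq_fun do rewrite big_ord0; exact: L1_cst.
under eq_fun do rewrite big_ord_recr/=.
by apply: L1_add; [apply: IH => i /ltnW; exact: h|exact: h].
Qed.

Local Notation Ex f := (\int[P]_w f w)%R.

Lemma Ex_add f g : L1 f -> L1 g -> Ex (fun w => f w + g w) = Ex f + Ex g.
Proof. by move=> fi gi; rewrite RintegralD. Qed.

Lemma Ex_sub f g : L1 f -> L1 g -> Ex (fun w => f w - g w) = Ex f - Ex g.
Proof. by move=> fi gi; rewrite RintegralB. Qed.

Lemma Ex_scale r f : L1 f -> Ex (fun w => r * f w) = r * Ex f.
Proof. by move=> fi; rewrite RintegralZl. Qed.

Lemma Ex_cst r : Ex (fun=> r) = r.
Proof. by rewrite Rintegral_cst//= -[RHS]mulr1; congr (_ * _); have -> := probability_setT P. Qed.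

Lemma Ex_le f g : L1 f -> L1 g -> (forall w, f w <= g w) -> Ex f <= Ex g.
Proof. by move=> fi gi fg; exact: le_Rintegral. Qed.

Lemma Ex_sum n (F : nat -> T -> R) :
  (forall i, (i < n)%N -> L1 (F i)) ->
  Ex (fun w => \sum_(i < n) F i w) = \sum_(i < n) Ex (F i).
Proof.
elim: n => [|n IH] h.
  by rewrite big_ord0; under eq_Rintegral do rewrite big_ord0; exact: Ex_cst.
under eq_Rintegral do rewrite big_ord_recr/=.
rewrite Ex_add ?IH ?big_ord_recr//; last exact: h.
- by move=> i /ltnW; exact: h.
- by apply: L1_sum => i /ltnW; exact: h.
Qed.

Lemma Ex_EFin f : L1 f -> (Ex f)%:E = (\int[P]_w (f w)%:E)%E.
Proof. by move=> fi; rewrite fineK//; exact: integrable_fin_num. Qed.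

Lemma Ex_indic (A : set T) : measurable A -> (Ex (\1_A))%:E = P A.
Proof.
move=> mA; rewrite Ex_EFin; last first.
  apply: (@L1_le _ (fun=> 1)) (L1_cst 1) => //.
  by move=> w; rewrite indicE; case: (_ \in _); rewrite ?normr1 ?normr0.
by rewrite integral_indic// setIT.
Qed.

Lemma L1_indic (A : set T) : measurable A -> L1 (\1_A).
Proof.
move=> mA; apply: (@L1_le _ (fun=> 1)) (L1_cst 1) => //.
by move=> w; rewrite indicE; case: (_ \in _); rewrite ?normr1 ?normr0.
Qed.

Lemma L2_mulL1 f g : L2 f -> L2 g -> L1 (fun w => f w * g w).
Proof.
move=> [mf fi] [mg gi].
apply: (L1_le _ _ (L1_add fi gi)); first exact: measurable_funM.
move=> w; rewrite ler_norml; apply/andP; split; nra.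
Qed.

Lemma L2_add f g : L2 f -> L2 g -> L2 (fun w => f w + g w).
Proof.
move=> [mf fi] [mg gi]; split; first exact: measurable_funD.
apply: (L1_le _ _ (L1_scale 2 (L1_add fi gi))).
  by apply: measurable_funX; exact: measurable_funD.
move=> w; rewrite ger0_norm ?sqr_ge0//.
have := sqr_ge0 (f w - g w); nra.
Qed.

Lemma L2_bmul (C : R) v f : measurable_fun setT v -> (forall w, `|v w| <= C) ->
  L2 f -> L2 (fun w => v w * f w).
Proof.
move=> mv vC [mf fi]; split; first exact: measurable_funM.
apply: (L1_le _ _ (L1_scale (C ^+ 2) fi)).
  by apply: measurable_funX; exact: measurable_funM.
move=> w; rewrite ger0_norm ?sqr_ge0// exprMn ler_wpM2r ?sqr_ge0//.
by rewrite -(real_normK (num_real (v w))) lerXn2r ?nnegrE// (le_trans _ (vC w)).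
Qed.

Lemma L2_cst r : L2 (fun=> r).
Proof. by split => //; exact: L1_cst. Qed.

Lemma L2_L1 f : L2 f -> L1 f.
Proof.
by move=> /L2_mulL1 /(_ (L2_cst 1)); under eq_fun do rewrite mulr1.
Qed.

Lemma L2_le f g : measurable_fun setT f -> (forall w, `|f w| <= g w) ->
  L2 g -> L2 f.
Proof.
move=> mf fg [mg gi]; split => //.
apply: (L1_le _ _ gi); first exact: measurable_funX.
move=> w; rewrite ger0_norm ?sqr_ge0// -real_normK ?num_real//.
by rewrite lerXn2r ?nnegrE// (le_trans _ (fg w)).
Qed.

Lemma L2_norm f : L2 f -> L2 (fun w => `|f w|).
Proof.
move=> [mf fi]; split; first exact: measurableT_comp.
by under eq_fun do rewrite real_normK ?num_real//.
Qed.

Lemma L2_sum n (F : nat -> T -> R) :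
  (forall i, (i < n)%N -> L2 (F i)) -> L2 (fun w => \sum_(i < n) F i w).
Proof.
elim: n => [|n IH] h.
  by under eq_fun do rewrite big_ord0; exact: L2_cst.
under eq_fun do rewrite big_ord_recr/=.
by apply: L2_add; [apply: IH => i /ltnW; exact: h|exact: h].
Qed.

(** Quantitative uniform integrability: an event of probability at most [r ^+ 2] contributes only
    [O(r)] to the mean of an L2-bounded variable. This is what allows exceptional events to be
    discarded. *)
Lemma Ex_mul_indic_le f (A : set T) (N r : R) : measurable A -> L2 f ->
  Ex (fun w => f w ^+ 2) <= N -> 0 < r -> Ex (\1_A) <= r ^+ 2 ->
  `|Ex (fun w => f w * \1_A w)| <= r * (N + 1).
Proof.
move=> mA fL fN r0 Ar.
have AL : L2 (\1_A : T -> R).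
  split => //; rewrite (_ : (fun w => \1_A w ^+ 2) = \1_A); first exact: L1_indic.
  by apply/funext => w; rewrite indicE; case: (_ \in _); rewrite ?expr1n ?expr0n.
have AE w : (\1_A w : R) ^+ 2 = \1_A w.
  by rewrite indicE; case: (_ \in _); rewrite ?expr1n ?expr0n.
(* AM-GM: [|f 1_A| <= r f^2 + 1_A / r] *)
pose g w := r * f w ^+ 2 + r^-1 * \1_A w.
have gi : L1 g by apply: L1_add; apply: L1_scale; [exact: fL.2|exact: L1_indic].
have Eg : Ex g <= r * (N + 1).
  have i1 := fL.2; have i2 := L1_indic mA.
  rewrite /g Ex_add; [|exact: L1_scale|exact: L1_scale].
  rewrite !Ex_scale//.
  have : r^-1 * Ex (\1_A) <= r by rewrite mulrC ler_pdivrMr// -expr2.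
  have := ler_wpM2l (ltW r0) fN; lra.
have le w : `|f w * \1_A w| <= g w.
  rewrite /g; have : (0 : R) <= \1_A w by rewrite indicE.
  move: (AE w); move: (\1_A w) => i i2 i0.
  rewrite -[X in _ + _ * X]i2 normrM (ger0_norm i0) -(real_normK (num_real (f w))).
  move: (normr_ge0 (f w)); move: `|f w| => x xge0.
  have -> : r * x ^+ 2 + r^-1 * i ^+ 2 = r * (x ^+ 2 + (r^-1 * i) ^+ 2).
    by field; rewrite gt_eqF.
  have -> : x * i = r * (x * (r^-1 * i)) by field; rewrite gt_eqF.
  rewrite ler_wpM2l ?(ltW r0)//; move: (r^-1 * i) => y.
  by have := sqr_ge0 (x - y); have := sqr_ge0 (x + y); nra.
rewrite ler_norml; apply/andP; split.
  rewrite lerNl -mulN1r -Ex_scale; last exact: L2_mulL1.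
  apply: le_trans Eg; apply: Ex_le => //; first by apply: L1_scale; exact: L2_mulL1.
  by move=> w; rewrite mulN1r lerNl; have := le w; rewrite ler_norml => /andP[].
apply: le_trans Eg; apply: Ex_le => //; first exact: L2_mulL1.
by move=> w; have := le w; rewrite ler_norml => /andP[].
Qed.

End moments.
Notation Ex P f := (\int[P]_w f w)%R.

(** * Integration without measurability, and moments of the normal law *)

Section integrals.
Context {d : measure_display} {T : measurableType d} {R : realType}.
Variable mu : {measure set T -> \bar R}.
Local Open Scope ereal_scope.

(* No measurability of [f]: the integral of a nonnegative function is defined
   as a supremum over the simple functions below it. *)
Lemma ge0_integral_le_nnsfun (f : T -> \bar R) (B : \bar R) :
  (forall x, 0 <= f x) ->
  (forall h : {nnsfun T >-> R}, (forall x, (h x)%:E <= f x) ->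
     \int[mu]_x (h x)%:E <= B) ->
  \int[mu]_x f x <= B.
Proof.
move=> f0 hB; rewrite ge0_integralTE//.
by apply: ge_ereal_sup => _ /= [h hf <-]; rewrite -integralT_nnsfun hB.
Qed.

(** Simple functions below [f] are almost everywhere below [g], and these are measurable. Meant for
    an [f] that is a supremum over uncountably many times. *)
Lemma ae_ge0_le_integral_nonmeasurable (f g : T -> \bar R) :
  (forall x, 0 <= f x) -> (forall x, 0 <= g x) -> measurable_fun setT g ->
  {ae mu, forall x, f x <= g x} -> \int[mu]_x f x <= \int[mu]_x g x.
Proof.
move=> f0 g0 mg fg; apply: ge0_integral_le_nnsfun => // h hf.
apply: ae_ge0_le_integral => //.
- by move=> x _; rewrite lee_fin fun_ge0.
- exact/measurable_EFinP.
- by apply: filterS fg => x fx _; exact: le_trans (hf x) fx.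
Qed.

Lemma limn_einf_le_bound (u : (\bar R)^nat) (B : \bar R) :
  (forall n, u n <= B) -> limn_einf u <= B.
Proof.
move=> uB; rewrite limn_einf_lim; apply: lime_le.
  exact: is_cvg_einfs.
apply: nearW => n; apply: le_trans (uB n).
by apply: ereal_inf_lbound; exists n => /=.
Qed.

Lemma fatou_bound (f : nat -> T -> \bar R) (g : T -> \bar R) (B : \bar R) :
  (forall n, measurable_fun setT (f n)) -> (forall n x, 0 <= f n x) ->
  (forall n, \int[mu]_x f n x <= B) ->
  (forall x, f n x @[n --> \oo] --> g x) -> \int[mu]_x g x <= B.
Proof.
move=> mf f0 fB fg.
have -> : \int[mu]_x g x = \int[mu]_x limn_einf (f^~ x).
  apply: eq_integral => x _; rewrite is_cvg_limn_einfE; last by apply/cvg_ex; exists (g x).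
  by apply/esym/cvg_lim.
apply: (le_trans (fatou _ measurableT mf _)) => //.
exact: limn_einf_le_bound.
Qed.
End integrals.

Section calculus.
Context {R : realType}.
Local Notation mu := (@lebesgue_measure R).

Lemma is_derive1_continuous (F f : R -> R) :
  (forall x : R, is_derive x (1 : R) F (f x)) -> continuous F.
Proof.
move=> dF x; apply/differentiable_continuous/derivable1_diffP.
by have := dF x; case.
Qed.

Lemma integral_is_derive (F f : R -> R) (a b : R) : a < b ->
  (forall x : R, is_derive x (1 : R) F (f x)) -> continuous f ->
  (\int[mu]_(x in `[a, b]) (f x)%:E = (F b - F a)%:E)%E.
Proof.
move=> ab dF cf; have cF := is_derive1_continuous dF.
rewrite (continuous_FTC2 (F := F) ab)//.
- exact: continuous_subspaceT.
- split=> [x _||].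
  + by have := dF x; case.
  + by apply: cvg_at_right_filter; exact: cF.
  + by apply: cvg_at_left_filter; exact: cF.
- by move=> x _; rewrite derive1E; have := dF x => ?; rewrite derive_val.
Qed.
End calculus.

Section normal_moments.
Context {R : realType}.
Variables (s : R).
Hypothesis s0 : s != 0.
Local Notation mu := (@lebesgue_measure R).
Local Notation phi := (normal_pdf 0 s).
Local Notation N := (@normal_prob R 0 s).

(** Testing simple functions below [f] reduces the claim to indicators, where it is the definition
    of [normal_prob] by its density. *)
Lemma integral_normal_prob_le (f : R -> \bar R) :
  (forall x, 0 <= f x)%E -> measurable_fun setT f ->
  (\int[N]_x f x <= \int[mu]_x (f x * (phi x)%:E))%E.
Proof.
move=> f0 mf; apply: ge0_integral_le_nnsfun => // h hf.
have -> : (\int[N]_x (h x)%:E = \int[mu]_x (h x * phi x)%:E)%E.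
  under eq_integral do rewrite fimfunE -fsumEFin//.
  rewrite ge0_integral_fsum//; last 2 first.
  - by move=> r; exact/measurable_EFinP/measurable_funM.
  - by move=> r x _; rewrite lee_fin; exact: nnfun_muleindic_ge0.
  under [RHS]eq_integral.
    move=> x _; rewrite fimfunE mulrC mulr_fsumr -fsumEFin//; over.
  rewrite ge0_integral_fsum//; last 2 first.
  - move=> r; apply/measurable_EFinP/measurable_funM => //.
      exact: measurable_normal_pdf.
    by apply: measurable_funM.
  - move=> r x _; rewrite lee_fin mulr_ge0 ?normal_pdf_ge0//.
    by have := nnfun_muleindic_ge0 h r x; rewrite lee_fin.
  apply: eq_fsbigr => r; rewrite inE => -[x _ <-].
  under eq_integral do rewrite EFinM.
  rewrite ge0_integralZl ?lee_fin ?fun_ge0//; last first.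
    exact/measurable_EFinP/measurable_indic.
  rewrite integral_indic// setIT.
  under [RHS]eq_integral do rewrite mulrCA EFinM.
  rewrite ge0_integralZl ?lee_fin ?fun_ge0//=; last 2 first.
  - apply/measurable_EFinP/measurable_funM => //; exact: measurable_normal_pdf.
  - by move=> y _; rewrite lee_fin mulr_ge0 ?normal_pdf_ge0.
  congr (_ * _)%E; rewrite /normal_prob integral_mkcond; apply: eq_integral => y _.
  rewrite patchE indicE; case: ifPn => /= _; by rewrite ?mulr1 ?mulr0.
apply: ge0_le_integral => //.
- by move=> x _; rewrite lee_fin mulr_ge0 ?fun_ge0 ?normal_pdf_ge0.
- by apply/measurable_EFinP/measurable_funM => //; exact: measurable_normal_pdf.
- by apply: emeasurable_funM => //; apply/measurable_EFinP; exact: measurable_normal_pdf.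
- by move=> x _; rewrite EFinM lee_wpmul2r// lee_fin normal_pdf_ge0.
Qed.

Let phi_deriv (x : R) : is_derive x 1 phi (- (x / s ^+ 2) * phi x).
Proof.
rewrite normal_pdfE// /normal_fun /=.
have -> : (fun x0 : R => normal_peak s * expR (- (x0 - 0) ^+ 2 / (s ^+ 2 *+ 2))) =
  (fun x0 : R => normal_peak s * expR ((- (s ^+ 2 *+ 2)^-1) * x0 ^+ 2)).
  by apply/funext => y; rewrite subr0; congr (_ * expR _); field.
apply: is_derive_eq.
rewrite /GRing.scale /=.
set e := expR _. rewrite subr0.
have -> : expR (- x ^+ 2 / (s ^+ 2 *+ 2)) = e by rewrite /e mulNr mulNr [_^-1 * _]mulrC.
by field.
Qed.

(** Since [phi' = - (x / s^2) phi], differentiating [- s^2 (x + 2 K) phi] gives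
    [(x (x + 2 K) - s^2) phi], and [x (x + 2 K) = (x + K)^2 - K^2]: this is the antiderivative of
    the centred second moment. *)
Let F (K x : R) := - s ^+ 2 * (x + 2 * K) * phi x.

Let F_deriv (K x : R) :
  is_derive x 1 (F K) (((x + K) ^+ 2 - (s ^+ 2 + K ^+ 2)) * phi x).
Proof.
have := phi_deriv x => ?.
rewrite /F; apply: is_derive_eq.
rewrite /GRing.scale /=; by field.
Qed.

(* As [K] is arbitrary, this says that the mean is 0 and the variance at most
   [s ^+ 2]. *)
Lemma normal_shifted_moment_le (K : R) :
  (\int[N]_x ((x + K) ^+ 2)%:E <= (s ^+ 2 + K ^+ 2)%:E)%E.
Proof.
apply: (le_trans (@integral_normal_prob_le (fun x => ((x + K) ^+ 2)%:E) _ _)).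
- by move=> x; rewrite lee_fin sqr_ge0.
- by apply/measurable_EFinP; apply: measurable_funX; exact: measurable_funD.
pose D (n : nat) : set R := `[- n.+1%:R, n.+1%:R]%classic.
have phi0 x : 0 <= phi x by exact: normal_pdf_ge0.
have mphi : measurable_fun setT phi by exact: measurable_normal_pdf.
have cphi : continuous phi by exact: continuous_normal_pdf.
have mxK : measurable_fun setT (fun x : R => (x + K) ^+ 2).
  by apply: measurable_funX; exact: measurable_funD.
have mD n : measurable (D n) by exact: measurable_itv.
have mI n : measurable_fun setT (fun x : R => (x + K) ^+ 2 * phi x * \1_(D n) x).
  apply: measurable_funM; last exact: measurable_indic.
  exact: measurable_funM.
apply: (@fatou_bound _ _ _ mu
  (fun n x => ((x + K) ^+ 2 * phi x * \1_(D n) x)%:E)).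
- by move=> n; apply/measurable_EFinP; exact: (mI n).
- by move=> n x; rewrite lee_fin mulr_ge0 ?indicE ?ler0n// mulr_ge0 ?sqr_ge0.
- move=> n; set c := s ^+ 2 + K ^+ 2.
  have -> : (\int[mu]_x ((x + K) ^+ 2 * phi x * \1_(D n) x)%:E =
    \int[mu]_(x in D n) (((x + K) ^+ 2 - c) * phi x + c * phi x)%:E)%E.
    rewrite [RHS]integral_mkcond; apply: eq_integral => x _.
    rewrite patchE indicE; case: ifPn => _ /=; rewrite ?mulr0// mulr1.
    by congr (_%:E); ring.
  have cx : continuous (fun x : R => ((x + K) ^+ 2 - c) * phi x).
    move=> x; apply: cvgM; last exact: cphi.
    apply: cvgB; last exact: cvg_cst.
    apply: (@continuous_comp _ _ _ (fun x : R => x + K) (fun x => x ^+ 2)).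
      by apply: cvgD; [exact: cvg_id|exact: cvg_cst].
    exact: sqr_continuous.
  have ccx : continuous (fun x : R => c * phi x).
    by move=> x; apply: cvgM; [exact: cvg_cst|exact: cphi].
  have compD : compact (D n) by exact: segment_compact.
  under eq_integral do rewrite EFinD.
  rewrite integralD//; last 2 first.
  - by apply: (continuous_compact_integrable compD); exact: continuous_subspaceT.
  - by apply: (continuous_compact_integrable compD); exact: continuous_subspaceT.
  have ab : - n.+1%:R < n.+1%:R :> R by rewrite gtrN.
  have /eqP := integral_is_derive ab (F_deriv K) cx.
  rewrite eq_le => /andP[iF _].
  rewrite -[leRHS]add0e; apply: leeD.
    (* As [phi] is even, the terms in [K] cancel at the two endpoints and the boundary term is
       [- 2 s^2 m phi(m) <= 0] with [m = n + 1]. *)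
    apply: (le_trans iF); rewrite lee_fin /F.
    have -> : phi (- n.+1%:R) = phi n.+1%:R.
      by rewrite !normal_pdfE// /normal_fun !subr0 sqrrN.
    have : 0 <= s ^+ 2 * (n.+1%:R * phi n.+1%:R).
      by apply: mulr_ge0; [exact: sqr_ge0|apply: mulr_ge0; [exact: ler0n|exact: phi0]].
    move: (phi _) => y; move: (n.+1%:R) => m; nra.
  have c0 : 0 <= c by rewrite addr_ge0 ?sqr_ge0.
  under eq_integral do rewrite EFinM.
  rewrite ge0_integralZl//; last 2 first.
  - by apply/measurable_EFinP/measurable_funTS.
  - by move=> x _; rewrite lee_fin.
  rewrite -[leRHS]mule1 lee_wpmul2l ?lee_fin//.
  rewrite -(integral_normal_pdf 0 s); apply: ge0_subset_integral => //.
  - exact: (mD n).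
  - exact/measurable_EFinP.
  - by move=> x _; rewrite lee_fin.
  - exact: (mD n).
  - exact: (mD n).
move=> x; apply: cvg_near_cst.
have [m xm] : exists m : nat, `|x| <= m%:R by exists (Num.bound `|x|); exact/ltW/archi_boundP.
exists m => // n /= mn.
rewrite indicE mem_set ?mulr1 ?EFinM//= /D/= in_itv/= -ler_norml.
by rewrite (le_trans xm)// ler_nat (leq_trans mn (leqnSn n)).
Qed.

End normal_moments.

(** * Expectations of products of independent variables *)

Section independence.
Context {d : measure_display} {T : measurableType d} {R : realType}.
Variable P : probability T R.
Variables V D : T -> R.
Hypotheses (mV : measurable_fun setT V) (mD : measurable_fun setT D).
Hypothesis VD : forall A B : set R, measurable A -> measurable B ->
  P (V @^-1` A `&` D @^-1` B) = (P (V @^-1` A) * P (D @^-1` B))%E.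

Let VR : {RV P >-> R} :=
  HB.pack V (@isMeasurableFun.Build _ _ _ _ V mV).
Let DR : {RV P >-> R} :=
  HB.pack D (@isMeasurableFun.Build _ _ _ _ D mD).
Let VDf (w : T) : (R * R)%type := (V w, D w).
Let mVDf : measurable_fun setT VDf.
Proof. exact: measurable_fun_pair. Qed.
Let VDR : {RV P >-> (R * R)%type} :=
  HB.pack VDf (@isMeasurableFun.Build _ _ _ _ VDf mVDf).

(** The law of the pair agrees with the product of the laws on rectangles, hence everywhere; Tonelli
    then splits the integral. *)
Lemma indep_ge0_integralM (f g : R -> R) :
  measurable_fun setT f -> measurable_fun setT g ->
  (forall x, 0 <= f x) -> (forall x, 0 <= g x) ->
  (\int[P]_w (f (V w) * g (D w))%:E =
   \int[P]_w (f (V w))%:E * \int[P]_w (g (D w))%:E)%E.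
Proof.
move=> mf mg f0 g0.
pose h (z : R * R) : \bar R := (f z.1 * g z.2)%:E.
have mh : measurable_fun setT h.
  apply/measurable_EFinP/measurable_funM.
    exact: (measurableT_comp mf measurable_fst).
  exact: (measurableT_comp mg measurable_snd).
have h0 z : (0 <= h z)%E by rewrite lee_fin mulr_ge0.
transitivity (\int[distribution P VDR]_z h z)%E.
  by rewrite ge0_integral_distribution.
rewrite (eq_measure_integral (distribution P VR \x distribution P DR)%E); last first.
  by move=> A mA _; apply/esym; apply: product_measure_unique => // B C mB mC; exact: VD.
rewrite fubini_tonelli1// /fubini_F.
transitivity (\int[distribution P VR]_x ((f x)%:E * \int[P]_w (g (D w))%:E))%E.
  apply: eq_integral => x _; rewrite /h /=.
  under eq_integral do rewrite EFinM.
  rewrite ge0_integralZl ?lee_fin//; last 2 first.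
  - exact/measurable_EFinP.
  - by move=> y _; rewrite lee_fin.
  congr (_ * _)%E.
  rewrite (@ge0_integral_distribution _ _ _ _ _ _ DR (fun y => (g y)%:E))//.
    exact/measurable_EFinP.
rewrite ge0_integralZr//; last 3 first.
- exact/measurable_EFinP.
- by move=> y _; rewrite lee_fin.
- by apply: integral_ge0 => w _; rewrite lee_fin.
congr (_ * _)%E.
rewrite (@ge0_integral_distribution _ _ _ _ _ _ VR (fun y => (f y)%:E))//.
exact/measurable_EFinP.
Qed.

Lemma indep_Ex_ge0M (f g : R -> R) :
  measurable_fun setT f -> measurable_fun setT g ->
  (forall x, 0 <= f x) -> (forall x, 0 <= g x) ->
  L1 P (f \o V) -> L1 P (g \o D) ->
  L1 P (fun w => f (V w) * g (D w)) /\
  Ex P (fun w => f (V w) * g (D w)) = Ex P (f \o V) * Ex P (g \o D).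
Proof.
move=> mf mg f0 g0 fi gi.
have E := indep_ge0_integralM mf mg f0 g0.
have i : L1 P (fun w => f (V w) * g (D w)).
  apply/integrableP; split.
    apply/measurable_EFinP/measurable_funM; exact: measurableT_comp.
  under eq_integral do rewrite /= ger0_norm ?mulr_ge0//.
  by rewrite E -(Ex_EFin fi) -(Ex_EFin gi) -EFinM ltry.
split => //; apply: EFin_inj; rewrite Ex_EFin// E EFinM.
by rewrite (Ex_EFin fi) (Ex_EFin gi).
Qed.

(** Split both variables into positive and negative parts. As [D] has mean 0, its two parts have the
    same mean, so the four product expectations cancel in pairs. *)
Lemma indep_ExM_eq0 : L2 P V -> L2 P D -> Ex P D = 0 ->
  Ex P (fun w => V w * D w) = 0.
Proof.
move=> V2 D2 D0.
pose p (x : R) := Num.max x 0; pose q (x : R) := Num.max (- x) 0.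
have mp : measurable_fun setT p by apply: measurable_maxr.
have mq : measurable_fun setT q by apply: measurable_maxr.
have p0 x : 0 <= p x by rewrite le_max lexx orbT.
have q0 x : 0 <= q x by rewrite le_max lexx orbT.
have pqE x : x = p x - q x.
  by rewrite /p /q; have [?|?] := lerP x 0; have [?|?] := lerP (- x) 0; lra.
have pn x : `|p x| <= `|x|.
  by rewrite ger0_norm// /p ge_max normr_ge0 ler_norm.
have qn x : `|q x| <= `|x|.
  by rewrite ger0_norm// /q ge_max normr_ge0 -normrN ler_norm.
have iV (r : R -> R) : measurable_fun setT r -> (forall x, `|r x| <= `|x|) -> L1 P (r \o V).
  move=> mr rn; apply: (L1_le (g := fun w => `|V w|)).
  - exact: measurableT_comp.
  - by move=> w; exact: rn.
  - exact/L2_L1/L2_norm.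
have iD (r : R -> R) : measurable_fun setT r -> (forall x, `|r x| <= `|x|) -> L1 P (r \o D).
  move=> mr rn; apply: (L1_le (g := fun w => `|D w|)).
  - exact: measurableT_comp.
  - by move=> w; exact: rn.
  - exact/L2_L1/L2_norm.
have [ipp Epp] := indep_Ex_ge0M mp mp p0 p0 (iV _ mp pn) (iD _ mp pn).
have [ipq Epq] := indep_Ex_ge0M mp mq p0 q0 (iV _ mp pn) (iD _ mq qn).
have [iqp Eqp] := indep_Ex_ge0M mq mp q0 p0 (iV _ mq qn) (iD _ mp pn).
have [iqq Eqq] := indep_Ex_ge0M mq mq q0 q0 (iV _ mq qn) (iD _ mq qn).
have EpD : Ex P (p \o D) = Ex P (q \o D).
  apply/eqP; rewrite -subr_eq0 -Ex_sub ?iD//; apply/eqP; rewrite -[RHS]D0.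
  by apply: eq_Rintegral => w _ /=; rewrite -pqE.
transitivity (Ex P (fun w => (p (V w) * p (D w) + q (V w) * q (D w)) -
    (p (V w) * q (D w) + q (V w) * p (D w)))).
  by apply: eq_Rintegral => w _; rewrite {1}(pqE (V w)) {1}(pqE (D w)); ring.
rewrite Ex_sub ?Ex_add ?Epp ?Epq ?Eqp ?Eqq ?EpD//; last 2 first.
- exact: L1_add.
- exact: L1_add.
ring.
Qed.

Lemma indep_Ex_sqrM_le (r : R) : L2 P V -> L2 P D -> Ex P (fun w => D w ^+ 2) <= r ->
  L2 P (fun w => V w * D w) /\
  Ex P (fun w => (V w * D w) ^+ 2) <= Ex P (fun w => V w ^+ 2) * r.
Proof.
move=> V2 D2 Dr.
have m2 : measurable_fun setT (fun x : R => x ^+ 2) by exact: measurable_funX.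
have [i E] := indep_Ex_ge0M m2 m2 (fun x => sqr_ge0 x) (fun x => sqr_ge0 x) V2.2 D2.2.
split.
  split; first exact: measurable_funM.
  by under eq_fun do rewrite exprMn.
under eq_Rintegral do rewrite exprMn.
rewrite E ler_wpM2l//; apply: Rintegral_ge0 => w _; exact: sqr_ge0.
Qed.

End independence.

(** * Increments of a Wiener process *)

Section generated.
Context {d : measure_display} {T : measurableType d} {R : realType}.
Variable G : set (set T).

Lemma measurable_wrtP (Z : T -> R) :
  measurable_wrt <<s G>> Z <-> measurable_fun [set: g_sigma_algebraType G] Z.
Proof.
split => [h _ B mB|h B mB]; first by rewrite setTI; exact: h.
by have := h measurableT B mB; rewrite setTI.
Qed.
End generated.

Section wiener.
Context {d : measure_display} {T : measurableType d} {R : realType}.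
Variables (P : probability T R) (W : R -> T -> R).
Hypothesis HW : wiener_process P W.
Local Notation F := (augmented_filtration P W).

Lemma natural_filtration_measurable (t : R) A : natural_filtration W t A -> measurable A.
Proof.
apply: smallest_sub; first exact: sigma_algebra_measurable.
move=> B [u [C [/andP[u0 _] mC ->]]].
by rewrite -[X in measurable X]setTI; exact: (wiener_measurable HW).
Qed.

Lemma augmented_filtration_measurable t A : F t A -> measurable A.
Proof.
apply: smallest_sub; first exact: sigma_algebra_measurable.
by move=> B [/natural_filtration_measurable//|[]].
Qed.

Lemma augmented_filtration_le s t A : s <= t -> F s A -> F t A.
Proof.
move=> st; apply: sub_sigma_algebra2 => B [|]; last by right.
move=> h; left; move: h; apply: sub_sigma_algebra2 => C [u [D [/andP[u0 us] mD ->]]].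
by exists u, D; split => //; rewrite u0 (le_trans us).
Qed.

Lemma measurable_wrt_le s t (Z : T -> R) : s <= t -> measurable_wrt (F s) Z -> measurable_wrt (F t) Z.
Proof. by move=> st h B mB; apply: (augmented_filtration_le st); exact: h. Qed.

Lemma measurable_wrt_measurable t (Z : T -> R) : measurable_wrt (F t) Z -> measurable_fun setT Z.
Proof.
by move=> h _ B mB; rewrite setTI; apply: (@augmented_filtration_measurable t); exact: h.
Qed.

Lemma wiener_adapted u t : 0 <= u -> u <= t -> measurable_wrt (F t) (W u).
Proof.
move=> u0 ut B mB; apply: sub_sigma_algebra; left.
by apply: sub_sigma_algebra; exists u, B; rewrite u0.
Qed.

(** The natural sigma-algebra together with the null events is stable under intersection and
    generates the augmented one. The finite measures [C |-> P (C & D)] and [C |-> P C * P D] agree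
    on it, by independence or because both vanish, hence on all of [F s]. *)
Lemma augmented_independent (s t : R) (A : set T) (B : set R) :
  0 <= s -> s < t -> F s A -> measurable B ->
  P (A `&` [set w | B (W t w - W s w)]) =
    (P A * P [set w | B (W t w - W s w)%R])%E.
Proof.
move=> s0 st FA mB.
set D := [set w | _].
have mD : measurable D.
  have := measurable_funB (wiener_measurable HW (le_trans s0 (ltW st)))
    (wiener_measurable HW s0).
  by move=> /(_ measurableT B mB); rewrite setTI.
have PDfin : P D \is a fin_num by exact: fin_num_measure.
have PD0 : 0 <= fine (P D) by rewrite fine_ge0.
pose m1 : {measure set T -> \bar R} := mrestr P mD.
pose m2 : {measure set T -> \bar R} := mscale (NngNum PD0) P.
have m1E C : m1 C = P (C `&` D) by [].
have m2E C : m2 C = (P C * P D)%E.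
  by rewrite muleC -[in RHS](fineK PDfin).
suff : m1 A = m2 A by rewrite m1E m2E.
pose G := natural_filtration W s `|` [set A | measurable A /\ P A = 0%E].
have GI : setI_closed G.
  move=> C E [gC|[mC C0]] [gE|[mE E0]].
  - left; have := @measurableI _ (g_sigma_algebraType
      [set A | exists (u : R) (B : set (measurableTypeR R)),
         [/\ 0 <= u <= s, measurable B & A = W u @^-1` B]]) C E gC gE.
    exact.
  - right; split; first by apply: measurableI => //; exact: natural_filtration_measurable gC.
    apply/eqP; rewrite eq_le measure_ge0 andbT -E0 le_measure ?inE//.
      by apply: measurableI => //; exact: natural_filtration_measurable gC.
  - right; split; first by apply: measurableI => //; exact: natural_filtration_measurable gE.
    apply/eqP; rewrite eq_le measure_ge0 andbT -C0 le_measure ?inE//.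
      by apply: measurableI => //; exact: natural_filtration_measurable gE.
  - right; split; first exact: measurableI.
    by apply/eqP; rewrite eq_le measure_ge0 andbT -C0 le_measure ?inE//; exact: measurableI.
apply: (@g_sigma_algebra_measure_unique _ _ _ G _ (fun=> setT)) => //.
- by move=> C [/natural_filtration_measurable//|[]].
- move=> _; left; exact: (@measurableT _ (g_sigma_algebraType
      [set A | exists (u : R) (B : set (measurableTypeR R)),
         [/\ 0 <= u <= s, measurable B & A = W u @^-1` B]])).
- by rewrite bigcup_const.
- move=> C [gC|[mC C0]].
    by rewrite m1E m2E; exact: (wiener_independent HW s0 st gC mB).
  rewrite m1E m2E C0 mul0e.
  by apply/eqP; rewrite eq_le measure_ge0 andbT -C0 le_measure ?inE//; exact: measurableI.
- by move=> _; rewrite m1E setTI ltey_eq PDfin.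
Qed.

Section increment.
Variables (p q : R).
Hypotheses (p0 : 0 <= p) (pq : p < q).
Local Notation D := (fun w => W q w - W p w).

Lemma increment_measurable : measurable_fun setT D.
Proof.
apply: measurable_funB; apply: (wiener_measurable HW) => //.
exact: le_trans p0 (ltW pq).
Qed.

Let sq0 : Num.sqrt (q - p) != 0.
Proof. by rewrite gt_eqF// sqrtr_gt0 subr_gt0. Qed.

Let shifted (K : R) : (\int[P]_w ((D w + K) ^+ 2)%:E <= (q - p + K ^+ 2)%:E)%E.
Proof.
have mf : measurable_fun setT (fun x : measurableTypeR R => ((x + K) ^+ 2)%:E).
  apply/measurable_EFinP.
  have h : measurable_fun setT (fun x : R => (x + K) ^+ 2).
    by apply: measurable_funX; exact: measurable_funD.
  exact: h.
have mD : @measurable_fun _ _ T (measurableTypeR R) setT D.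
  exact: increment_measurable.
pose DR : {RV P >-> measurableTypeR R} :=
  HB.pack D (@isMeasurableFun.Build _ _ T (measurableTypeR R) D mD).
have f0 (x : measurableTypeR R) : (0 <= ((x + K) ^+ 2)%:E)%E by rewrite lee_fin sqr_ge0.
have <- := @ge0_integral_distribution _ _ _ _ _ P DR _ mf f0.
rewrite (eq_measure_integral (@normal_prob R 0 (Num.sqrt (q - p)))); last first.
  by move=> A mA _; exact: (wiener_gaussian HW p0 pq mA).
apply: (le_trans (normal_shifted_moment_le sq0 K)).
by rewrite sqr_sqrtr// subr_ge0 ltW.
Qed.

Lemma increment_L2 : L2 P D.
Proof.
split; first exact: increment_measurable.
apply/integrableP; split.
  by apply/measurable_EFinP/measurable_funX; exact: increment_measurable.
have := shifted 0; rewrite expr0n/= addr0.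
under eq_integral do rewrite addr0.
under [X in _ -> (X < _)%E]eq_integral do rewrite /= ger0_norm ?sqr_ge0//.
by move=> /le_lt_trans; apply; rewrite ltry.
Qed.

Let shiftedE (K : R) : Ex P (fun w => D w ^+ 2) + 2 * K * Ex P D <= q - p.
Proof.
have iD := L2_L1 increment_L2.
have iD2 := increment_L2.2.
have i2 : L1 P (fun w => (2 * K) * D w) by exact: L1_scale.
have E : Ex P (fun w => (D w + K) ^+ 2) =
    Ex P (fun w => D w ^+ 2) + 2 * K * Ex P D + K ^+ 2.
  transitivity (Ex P (fun w => (D w ^+ 2 + (2 * K) * D w) + K ^+ 2)).
    by apply: eq_Rintegral => w _; ring.
  by rewrite (Ex_add (L1_add iD2 i2) (L1_cst P (K ^+ 2))) (Ex_add iD2 i2) (Ex_scale _ iD) Ex_cst.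
rewrite -(lerD2r (K ^+ 2)) -E -lee_fin Ex_EFin; first exact: shifted.
exact: (L2_add increment_L2 (L2_cst P K)).2.
Qed.

Lemma increment_Ex2 : Ex P (fun w => D w ^+ 2) <= q - p.
Proof. by have := shiftedE 0; rewrite mulr0 mul0r addr0. Qed.

(** By [shiftedE], an affine function of [K] with slope [2 E D] is bounded above on the whole line,
    so the slope is 0. The [K] substituted below would give [E D^2 + (q - p + 1) <= q - p]. *)
Lemma increment_Ex : Ex P D = 0.
Proof.
apply/eqP/negP => /negP e0.
have D0 : 0 <= Ex P (fun w => D w ^+ 2).
  by apply: Rintegral_ge0 => w _; exact: sqr_ge0.
have := shiftedE ((q - p + 1) / (2 * Ex P D)).
have -> : 2 * ((q - p + 1) / (2 * Ex P D)) * Ex P D = q - p + 1 by field.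
lra.
Qed.

Variable V : T -> R.
Hypotheses (VF : measurable_wrt (F p) V) (V2 : L2 P V).

Let indep (A B : set R) : measurable A -> measurable B ->
  P (V @^-1` A `&` D @^-1` B) = (P (V @^-1` A) * P (D @^-1` B))%E.
Proof. by move=> mA mB; apply: augmented_independent => //; exact: VF. Qed.

Lemma increment_ExM : Ex P (fun w => V w * (W q w - W p w)) = 0.
Proof.
exact: (indep_ExM_eq0 V2.1 increment_measurable indep V2 increment_L2 increment_Ex).
Qed.

Lemma increment_ExM2 : L2 P (fun w => V w * (W q w - W p w)) /\
  Ex P (fun w => (V w * (W q w - W p w)) ^+ 2) <= Ex P (fun w => V w ^+ 2) * (q - p).
Proof.
exact: (indep_Ex_sqrM_le V2.1 increment_measurable indep V2 increment_L2 increment_Ex2).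
Qed.
End increment.

End wiener.

(** * Discrete stochastic integrals and Doob's inequality *)

Section pathwise_doob.
Context {R : realType}.
Implicit Types m : nat -> R.

Fixpoint running_max m (n : nat) : R :=
  if n is n'.+1 then Num.max (running_max m n') `|m n| else `|m 0|.

Definition sgnr m (n : nat) : R := if 0 <= m n then 1 else -1.

Lemma running_max_ge m n j : (j <= n)%N -> `|m j| <= running_max m n.
Proof.
elim: n j => [|n IH] j /=; first by rewrite leqn0 => /eqP ->.
rewrite leq_eqVlt => /predU1P[->|/IH h]; first by rewrite le_max lexx orbT.
by rewrite le_max h.
Qed.

Lemma running_max_ge0 m n : 0 <= running_max m n.
Proof. exact: le_trans (normr_ge0 _) (running_max_ge m (leqnn n)). Qed.

(** The subtracted sum is a discrete integral against [m] whose integrand is known before each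
    increment. For a martingale it has mean 0, which leaves Doob's L2 inequality with its constant
    4. *)
Lemma pathwise_doob m n : m 0 = 0 ->
  running_max m n ^+ 2 <= 4 * m n ^+ 2
    - 4 * \sum_(i < n) running_max m i * sgnr m i * (m i.+1 - m i).
Proof.
move=> m0.
(* This linear form is what passes through the induction: if the maximum is unchanged only [|m|]
   moves, and if it jumps from [x] to [y] the slack is [(y - x)^2]. Completing the square in
   [running_max - 2 |m n|] then gives the claim. *)
suff h : running_max m n ^+ 2 <= 2 * running_max m n * `|m n|
    - 2 * \sum_(i < n) running_max m i * sgnr m i * (m i.+1 - m i).
  have := sqr_ge0 (running_max m n - 2 * `|m n|).
  move: h; rewrite -(real_normK (num_real (m n))).
  move: (running_max m n) `|m n| (\sum_(i < n) _) => x y z; nra.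
elim: n => [|n IH]; first by rewrite /= m0 normr0 big_ord0 expr0n/= !mulr0 subr0.
rewrite big_ord_recr/=; set S := \sum_(i < n) _ in IH *.
have x0 := running_max_ge0 m n.
have sg : sgnr m n * (m n.+1 - m n) <= `|m n.+1| - `|m n|.
  rewrite /sgnr; case: ifPn => [h|]; last first.
    rewrite -ltNge => h; rewrite (ltr0_norm h).
    by have := ler_norm (- m n.+1); rewrite normrN; lra.
  by rewrite (ger0_norm h); have := ler_norm (m n.+1); lra.
have := ler_wpM2l x0 sg; rewrite mulrA.
move: (running_max m n) x0 IH (_ * _ * (_ - _)) => x x0 IH z zle.
have y0 := normr_ge0 (m n.+1).
have [xy|yx] := leP x `|m n.+1|.
  move: `|m n.+1| `|m n| y0 xy zle IH => y u y0 xy zle IH; nra.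
move: `|m n.+1| `|m n| y0 yx zle IH => y u y0 xy zle IH; nra.
Qed.
End pathwise_doob.

Section discrete_martingale.
Context {d : measure_display} {T : measurableType d} {R : realType}.
Variables (P : probability T R) (W : R -> T -> R).
Hypothesis HW : wiener_process P W.
Local Notation F := (augmented_filtration P W).

Lemma wrt_cst t (r : R) : measurable_wrt (F t) (fun=> r : R).
Proof. exact/measurable_wrtP. Qed.

Lemma wrt_add t (f g : T -> R) : measurable_wrt (F t) f -> measurable_wrt (F t) g ->
  measurable_wrt (F t) (fun w => f w + g w).
Proof.
by move=> /measurable_wrtP mf /measurable_wrtP mg; apply/measurable_wrtP; exact: measurable_funD.
Qed.

Lemma wrt_sub t (f g : T -> R) : measurable_wrt (F t) f -> measurable_wrt (F t) g ->
  measurable_wrt (F t) (fun w => f w - g w).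
Proof.
by move=> /measurable_wrtP mf /measurable_wrtP mg; apply/measurable_wrtP; exact: measurable_funB.
Qed.

Lemma wrt_mul t (f g : T -> R) : measurable_wrt (F t) f -> measurable_wrt (F t) g ->
  measurable_wrt (F t) (fun w => f w * g w).
Proof.
by move=> /measurable_wrtP mf /measurable_wrtP mg; apply/measurable_wrtP; exact: measurable_funM.
Qed.

Lemma wrt_norm t (f : T -> R) : measurable_wrt (F t) f -> measurable_wrt (F t) (fun w => `|f w|).
Proof. by move=> /measurable_wrtP mf; apply/measurable_wrtP; exact: measurableT_comp. Qed.

Lemma wrt_max t (f g : T -> R) : measurable_wrt (F t) f -> measurable_wrt (F t) g ->
  measurable_wrt (F t) (fun w => Num.max (f w) (g w)).
Proof.
by move=> /measurable_wrtP mf /measurable_wrtP mg; apply/measurable_wrtP; exact: measurable_maxr.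
Qed.

Lemma wrt_if t (f1 f2 g1 g2 : T -> R) :
  measurable_wrt (F t) f1 -> measurable_wrt (F t) f2 ->
  measurable_wrt (F t) g1 -> measurable_wrt (F t) g2 ->
  measurable_wrt (F t) (fun w => if f1 w <= f2 w then g1 w else g2 w).
Proof.
move=> /measurable_wrtP mf1 /measurable_wrtP mf2 /measurable_wrtP mg1 /measurable_wrtP mg2.
by apply/measurable_wrtP; apply: measurable_fun_ifT => //; exact: measurable_fun_ler.
Qed.

Lemma wrt_sum t n (f : nat -> T -> R) :
  (forall i, (i < n)%N -> measurable_wrt (F t) (f i)) ->
  measurable_wrt (F t) (fun w => \sum_(i < n) f i w).
Proof.
elim: n => [|n IH] h.
  by under eq_fun do rewrite big_ord0; exact: wrt_cst.
under eq_fun do rewrite big_ord_recr/=.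
by apply: wrt_add; [apply: IH => i /ltnW; exact: h|exact: h].
Qed.

Variables (p : nat -> R) (v : nat -> T -> R) (C : R).
Hypotheses (p0 : 0 <= p 0%N) (ndp : forall i, p i <= p i.+1)
  (vF : forall i, measurable_wrt (F (p i)) (v i))
  (vC : forall i w, `|v i w| <= C).

Definition dsum (j : nat) (w : T) : R :=
  \sum_(i < j) v i w * (W (p i.+1) w - W (p i) w).
Local Notation M := dsum.

Let pge0 i : 0 <= p i.
Proof. by elim: i => // i IH; exact: le_trans IH (ndp i). Qed.

Let mv i : measurable_fun setT (v i).
Proof. exact: (measurable_wrt_measurable HW (vF (i := i))). Qed.

Let vL2 i (f : T -> R) : L2 P f -> L2 P (fun w => v i w * f w).
Proof. exact: L2_bmul. Qed.

Let step i (V : T -> R) : measurable_wrt (F (p i)) V -> L2 P V ->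
  [/\ L2 P (fun w => V w * (W (p i.+1) w - W (p i) w)),
      Ex P (fun w => V w * (W (p i.+1) w - W (p i) w)) = 0 &
      Ex P (fun w => (V w * (W (p i.+1) w - W (p i) w)) ^+ 2) <=
        Ex P (fun w => V w ^+ 2) * (p i.+1 - p i)].
Proof.
(* Grids may repeat points, while the law and the independence of increments are stated for [p < q]
   only. *)
move=> VF V2; have [->|ne] := eqVneq (p i.+1) (p i).
  split.
  - under eq_fun do rewrite subrr mulr0; exact: L2_cst.
  - by under eq_Rintegral do rewrite subrr mulr0; exact: Ex_cst.
  - rewrite subrr mulr0; under eq_Rintegral do rewrite subrr mulr0 expr0n/=.
    by rewrite Ex_cst.
have lt : p i < p i.+1 by rewrite lt_neqAle eq_sym ne ndp.
have [l2 e] := increment_ExM2 HW (pge0 i) lt VF V2.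
by split => //; exact: (increment_ExM HW (pge0 i) lt VF V2).
Qed.

Lemma dsum_adapted j : measurable_wrt (F (p j)) (M j).
Proof.
apply: (@wrt_sum (p j) j (fun i w => v i w * (W (p i.+1) w - W (p i) w))) => i ij.
have pij : p i.+1 <= p j.
  by apply: (homo_leq (r := fun x y => x <= y)) => //; exact: le_trans.
apply: wrt_mul; first exact: (measurable_wrt_le (le_trans (ndp i) pij) (vF (i := i))).
by apply: wrt_sub; apply: wiener_adapted => //; exact: le_trans (ndp i) pij.
Qed.

Let vstep i : [/\ L2 P (fun w => v i w * (W (p i.+1) w - W (p i) w)),
      Ex P (fun w => v i w * (W (p i.+1) w - W (p i) w)) = 0 &
      Ex P (fun w => (v i w * (W (p i.+1) w - W (p i) w)) ^+ 2) <=
        Ex P (fun w => v i w ^+ 2) * (p i.+1 - p i)].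
Proof.
apply: step => //; have := @vL2 i (fun=> 1) (L2_cst P 1).
by under eq_fun do rewrite mulr1.
Qed.

Lemma dsum_L2 j : L2 P (M j).
Proof.
apply: (@L2_sum _ _ _ _ j (fun i w => v i w * (W (p i.+1) w - W (p i) w))) => i _.
by have [] := vstep i.
Qed.

Lemma dsum_Ex j : Ex P (M j) = 0.
Proof.
rewrite /dsum (@Ex_sum _ _ _ _ _ (fun i w => v i w * (W (p i.+1) w - W (p i) w))).
  by rewrite big1// => i _; have [] := vstep i.
by move=> i _; have [/L2_L1] := vstep i.
Qed.

Let v2i i : L1 P (fun w => v i w ^+ 2 * (p i.+1 - p i)).
Proof.
under eq_fun do rewrite mulrC; apply: L1_scale.
by have := (@vL2 i (fun=> 1) (L2_cst P 1)).2; under eq_fun do rewrite mulr1.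
Qed.

(** One half of the Ito isometry. When the square is expanded, the cross term is an increment of [W]
    times [v j * M j], which is known at time [p j], so it has mean 0. *)
Lemma dsum_Ex2 j : Ex P (fun w => M j w ^+ 2) <=
  Ex P (fun w => \sum_(i < j) v i w ^+ 2 * (p i.+1 - p i)).
Proof.
elim: j => [|j IH].
  rewrite /dsum; under eq_Rintegral do rewrite big_ord0 expr0n/=.
  by under [leRHS]eq_Rintegral do rewrite big_ord0.
set D := fun w => v j w * (W (p j.+1) w - W (p j) w).
have [D2 D0 Dle] := vstep j.
have VL : L2 P (fun w => v j w * M j w) by apply: vL2; exact: dsum_L2.
have VF : measurable_wrt (F (p j)) (fun w => v j w * M j w).
  by apply: wrt_mul => //; exact: dsum_adapted.
have [MD2 MD0 _] := step VF VL.
have iM := (dsum_L2 j).2; have iD := D2.2; have iMD := L1_scale 2 (L2_L1 MD2).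
have -> : Ex P (fun w => M j.+1 w ^+ 2) = Ex P (fun w => M j w ^+ 2) +
    Ex P (fun w => (v j w * (W (p j.+1) w - W (p j) w)) ^+ 2).
  transitivity (Ex P (fun w => (M j w ^+ 2 + (v j w * (W (p j.+1) w - W (p j) w)) ^+ 2)
     + 2 * (v j w * M j w * (W (p j.+1) w - W (p j) w)))).
    by apply: eq_Rintegral => w _; rewrite /dsum big_ord_recr/=; ring.
  by rewrite (Ex_add (L1_add iM iD) iMD) (Ex_add iM iD) (Ex_scale _ (L2_L1 MD2)) MD0 mulr0 addr0.
under [leRHS]eq_Rintegral do rewrite big_ord_recr/=.
have i1 : L1 P (fun w => \sum_(i < j) v i w ^+ 2 * (p i.+1 - p i)).
  by apply: (@L1_sum _ _ _ _ _ (fun i w => v i w ^+ 2 * (p i.+1 - p i))) => i _.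
rewrite (Ex_add i1 (v2i j)); apply: lerD => //; apply: (le_trans Dle).
rewrite mulrC -Ex_scale.
  by under eq_Rintegral do rewrite mulrC.
by have := (@vL2 j (fun=> 1) (L2_cst P 1)).2; under eq_fun do rewrite mulr1.
Qed.

Definition mmax n w := running_max (fun j => M j w) n.

Let mmax_adapted j : measurable_wrt (F (p j)) (mmax j).
Proof.
elim: j => [|j IH]; first by apply: wrt_norm; exact: dsum_adapted.
apply: wrt_max; first exact: (measurable_wrt_le (ndp j) IH).
by apply: wrt_norm; exact: dsum_adapted.
Qed.

Lemma mmax_L2 j : L2 P (mmax j).
Proof.
elim: j => [|j IH]; first by apply: L2_norm; exact: dsum_L2.
have mm : measurable_fun setT (mmax j.+1).
  exact: (measurable_wrt_measurable HW (mmax_adapted (j := j.+1))).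
apply: (L2_le mm _ (L2_add IH (L2_norm (dsum_L2 j.+1)))).
move=> w; rewrite ger0_norm; last exact: running_max_ge0.
rewrite /mmax /= ge_max; apply/andP; split.
  by rewrite lerDl.
by rewrite lerDr; exact: running_max_ge0.
Qed.

(** The mean of [pathwise_doob]. Its correction sum is rewritten as an integral of [V i] against the
    increments of [W]; [V i] is known at time [p i] and square integrable, so the sum has mean 0. *)
Lemma dsum_doob n : Ex P (fun w => mmax n w ^+ 2) <=
  4 * Ex P (fun w => \sum_(i < n) v i w ^+ 2 * (p i.+1 - p i)).
Proof.
apply: (@le_trans _ _ (4 * Ex P (fun w => M n w ^+ 2))); last first.
  by rewrite ler_wpM2l//; exact: dsum_Ex2.
pose V i w := v i w * (sgnr (fun j => M j w) i * mmax i w).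
have VL i : L2 P (V i).
  apply: vL2; apply: (@L2_bmul _ _ _ _ 1); last exact: mmax_L2.
  - apply: (@measurable_wrt_measurable _ _ _ _ _ HW (p i)); apply: wrt_if; try exact: wrt_cst.
    exact: dsum_adapted.
  - by move=> w; rewrite /sgnr; case: ifPn; rewrite ?normrN normr1.
have VF i : measurable_wrt (F (p i)) (V i).
  apply: wrt_mul => //; apply: wrt_mul; last exact: mmax_adapted.
  by apply: wrt_if; try exact: wrt_cst; exact: dsum_adapted.
have st i := step (VF i) (VL i).
pose G i w := V i w * (W (p i.+1) w - W (p i) w).
have Gi i : L1 P (G i) by have [/L2_L1] := st i.
have SG : L1 P (fun w => \sum_(i < n) G i w) by apply: L1_sum => i _.
have iM := (dsum_L2 n).2.
rewrite -(Ex_scale 4 iM) -[leRHS]subr0.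
have <- : 4 * Ex P (fun w => \sum_(i < n) G i w) = 0.
  by rewrite Ex_sum ?big1 ?mulr0// => i _; have [] := st i.
rewrite -(Ex_scale 4 SG) -Ex_sub; [|exact: L1_scale|exact: L1_scale].
apply: Ex_le; first exact: (mmax_L2 n).2.
  by apply: L1_sub; exact: L1_scale.
move=> w; have m0 : M 0%N w = 0 by rewrite /dsum big_ord0.
apply: (le_trans (pathwise_doob n m0)).
rewrite lerD2l lerN2 ler_wpM2l//.
rewrite le_eqVlt; apply/orP; left; apply/eqP; apply: eq_bigr => i _.
rewrite /G /V /mmax {1}/dsum [X in _ * X = _]addrC.
have -> : M i.+1 w = M i w + v i w * (W (p i.+1) w - W (p i) w).
  by rewrite /dsum big_ord_recr.
by rewrite -/(M i w); ring.
Qed.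

End discrete_martingale.

(** * Simple processes on a grid *)

Section grids.
Context {R : realType}.
Implicit Types (p : nat -> R) (t x : R).

Definition grid p (n : nat) t := [/\ p 0%N = 0, p n = t & forall i, p i <= p i.+1].

Lemma grid_le p n t i j : grid p n t -> (i <= j)%N -> p i <= p j.
Proof.
by move=> [_ _ nd]; apply: (homo_leq (r := fun x y => x <= y)) => //; exact: le_trans.
Qed.

Lemma grid_ge0 p n t i : grid p n t -> 0 <= p i.
Proof. by move=> g; case: (g) => <- _ _; exact: (grid_le g). Qed.

Definition covers p n (x : R) := exists2 k, (k <= n)%N & p k = x.

Lemma grid_exists t (L : seq R) : 0 <= t ->
  exists p n, grid p n t /\
    forall x, x \in L -> 0 <= x -> x <= t -> covers p n x.
Proof.
move=> t0.
pose s := sort <=%R (0 :: t :: [seq x <- L | 0 <= x <= t]).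
have sE x : (x \in s) = (x \in 0 :: t :: [seq x <- L | 0 <= x <= t]) by rewrite mem_sort.
have sz : size s = (size [seq x <- L | 0 <= x <= t]).+2 by rewrite size_sort.
have ss : sorted <=%R s by exact: sort_le_sorted.
have sb x : x \in s -> 0 <= x <= t.
  rewrite sE !inE => /predU1P[->|/predU1P[->|]]; rewrite ?lexx ?t0//.
  by rewrite mem_filter => /andP[].
(* The default value [t], the largest element of [s], keeps [p] nondecreasing past the end of the
   list. *)
pose p i := nth t s i.
have pin i : (i < size s)%N -> p i \in s by move=> h; exact: mem_nth.
have pb i : 0 <= p i <= t.
  have [h|h] := ltnP i (size s); first exact/sb/pin.
  by rewrite /p nth_default// t0 lexx.
have nd i : p i <= p i.+1.
  have [h|h] := ltnP i.+1 (size s).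
    by apply: (sorted_leq_nth le_trans lexx t ss) => //; rewrite inE// ltnW.
  by rewrite [leRHS]/p nth_default//; have /andP[] := pb i.
have mono i j : (i <= j)%N -> p i <= p j.
  by apply: (homo_leq (r := fun x y => x <= y)) => //; exact: le_trans.
have cov x : x \in s -> covers p (size s).-1 x.
  move=> xs; exists (index x s); last exact: nth_index.
  by rewrite -ltnS prednK ?index_mem// sz.
exists p, (size s).-1; split; last first.
  by move=> x xL x0 xt; apply: cov; rewrite sE !inE mem_filter xL x0 xt !orbT.
split => //.
- have [|k _ k0] := cov 0; first by rewrite sE inE eqxx.
  apply/eqP; rewrite eq_le -[X in _ <= X]k0 mono//=.
  by have /andP[] := pb 0%N.
- have [|k kn kt] := cov t; first by rewrite sE !inE eqxx orbT.
  apply/eqP; rewrite eq_le -[X in _ && (X <= _)]kt mono// andbT.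
  by have /andP[] := pb (size s).-1.
Qed.

Lemma grid_trunc p n t j : grid p n t -> (j <= n)%N -> grid p j (p j).
Proof. by move=> [? ? ?]. Qed.

Lemma covers_trunc p n t j x : grid p n t -> (j <= n)%N -> x <= p j ->
  covers p n x -> covers p j x.
Proof.
move=> g jn xj [k kn kx]; have [kj|jk] := leqP k j; first by exists k.
by exists j => //; apply/eqP; rewrite eq_le xj -kx (grid_le g)// ltnW.
Qed.

(** No cell of the grid contains [x] in its interior: [x] is a grid point or lies beyond [t]. *)
Lemma grid_compat p n t x j : grid p n t -> 0 <= x -> (x <= t -> covers p n x) ->
  (j < n)%N -> p j < x -> p j.+1 <= x.
Proof.
move=> g x0 cx jn pjx; have [xt|tx] := leP x t.
  have [k kn kx] := cx xt; rewrite -kx (grid_le g)// ltnNge.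
  by apply/negP => kj; move: pjx; rewrite -kx ltNge (grid_le g).
by case: (g) => _ <- _ in tx *; apply/ltW/(le_lt_trans _ tx)/(grid_le g).
Qed.

(** The cells that start before [x] also end before it, so the sum telescopes and stops at
    [min t x]. *)
Lemma grid_threshold (f : R -> R) p n t x : grid p n t -> 0 <= x ->
  (x <= t -> covers p n x) ->
  \sum_(j < n) (p j < x)%R%:R * (f (p j.+1) - f (p j)) = f (Num.min t x) - f 0.
Proof.
move=> g x0 cx.
transitivity (\sum_(0 <= j < n) (f (Num.min (p j.+1) x) - f (Num.min (p j) x))).
  rewrite big_mkord; apply: eq_bigr => j _.
  have [pjx|xpj] := ltP (p j) x.
    by rewrite mul1r (min_idPl _)// (grid_compat g x0 cx).
  rewrite mul0r (min_idPr _) ?subrr// (le_trans xpj)//; exact: (grid_le g).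
rewrite telescope_sumr//; case: (g) => -> -> _.
by congr (_ - f _); rewrite (min_idPl _).
Qed.

(** The lower bound on [G] is asked on left-open cells because simple processes are constant on
    these; the induction splits off the last cell. *)
Lemma grid_integral_ge p n t (G : R -> \bar R) (c : nat -> R) : grid p n t ->
  measurable_fun `[0, t]%classic G -> (forall x, (0 <= G x)%E) ->
  (forall i, 0 <= c i) ->
  (forall j u, (j < n)%N -> p j < u -> u <= p j.+1 -> ((c j)%:E <= G u)%E) ->
  ((\sum_(j < n) c j * (p j.+1 - p j))%:E <=
     \int[lebesgue_measure]_(u in `[0%R, t]) G u)%E.
Proof.
move=> g mG G0 c0 cG; case: (g) => p0 <- nd in mG *.
suff h k : (k <= n)%N -> ((\sum_(j < k) c j * (p j.+1 - p j))%:E <=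
     \int[lebesgue_measure]_(u in `[0%R, p k]) G u)%E by exact: h.
elim: k => [_|k IH kn].
  by rewrite big_ord0; apply: integral_ge0.
rewrite big_ord_recr/= EFinD.
have pk0 : 0 <= p k by exact: (grid_ge0 k g).
have pkk := nd k; have pkn : p k.+1 <= p n by exact: (grid_le g).
have sub1 : `[0, p k]%classic `<=` `[0, p n]%classic.
  by move=> u /=; rewrite !in_itv/= => /andP[-> h]; rewrite (le_trans h)// (le_trans pkk).
have sub2 : `]p k, p k.+1]%classic `<=` `[0, p n]%classic.
  move=> u /=; rewrite !in_itv/= => /andP[h1 h2].
  by rewrite (le_trans pk0 (ltW h1)) (le_trans h2).
have -> : `[0, p k.+1]%classic = `[0, p k]%classic `|` `]p k, p k.+1]%classic.
  apply/seteqP; split => u /=; rewrite !in_itv/=.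
    by move=> /andP[u0 uk]; have [h|h] := leP u (p k); [left|right]; rewrite ?u0.
  move=> [/andP[-> h]|/andP[h1 h2]]; first by rewrite (le_trans h).
  by rewrite (le_trans pk0 (ltW h1)).
rewrite ge0_integral_setU//=; last 2 first.
- apply: (measurable_funS _ _ mG); first exact: measurable_itv.
  by move=> u [/sub1|/sub2].
- apply/disj_setPS => u [/=]; rewrite !in_itv/= => /andP[_ h1] /andP[h2 _].
  by move: (le_lt_trans h1 h2); rewrite ltxx.
apply: leeD; first exact/IH/ltnW.
have -> : (c k * (p k.+1 - p k))%:E =
    (\int[lebesgue_measure]_(u in `]p k, p k.+1]) (c k)%:E)%E.
  rewrite integral_cst//= lebesgue_measure_itv/= lte_fin.
  have [h|h] := ltP (p k) (p k.+1); first by rewrite -EFinD EFinM.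
  by rewrite mule0 (_ : p k.+1 = p k) ?subrr ?mulr0//; apply/eqP; rewrite eq_le h nd.
apply: ge0_le_integral => //=.
- by move=> u _; rewrite lee_fin.
- by apply: (measurable_funS _ sub2 mG); exact: measurable_itv.
- by move=> u; rewrite in_itv/= => /andP[h1 h2]; apply: cG.
Qed.
End grids.

Lemma measurable_fun_sumr d (T : measurableType d) (R : realType) (D : set T) n
    (f : nat -> T -> R) : (forall i, measurable_fun D (f i)) ->
  measurable_fun D (fun x => \sum_(i < n) f i x).
Proof.
move=> mf; elim: n => [|n IH].
  by under eq_fun do rewrite big_ord0; exact: measurable_cst.
by under eq_fun do rewrite big_ord_recr/=; exact: measurable_funD.
Qed.

Section simple_processes.
Context {d : measure_display} {T : measurableType d} {R : realType}.
Variables (P : probability T R) (W : R -> T -> R).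
Hypothesis HW : wiener_process P W.
Local Notation F := (augmented_filtration P W).
Implicit Type S : @simple_process d T R.

(* The right limit at [u] of the left-continuous [simple_value S]; unlike
   [simple_value S u] on the interval that follows, it is known at time [u]. *)
Definition simple_right_value S (u : R) (w : T) : R :=
  \sum_(i < simple_size S)
    simple_coef S i w * (simple_grid S i <= u < simple_grid S i.+1)%R%:R.

Local Notation rv := simple_right_value.

Definition grid_covers (p : nat -> R) n t S := forall i : nat,
  simple_grid S i <= t -> (i <= simple_size S)%N -> covers p n (simple_grid S i).

Lemma right_value_adapted S (u : R) : simple_wf P W S -> measurable_wrt (F u) (rv S u).
Proof.
move=> [g0 ndg cF _].
apply: (@wrt_sum _ _ _ P W u _ (fun i w => simple_coef S i w *
  (simple_grid S i <= u < simple_grid S i.+1)%R%:R)) => i iS.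
have [/andP[gu ug]|h] := boolP (simple_grid S i <= u < simple_grid S i.+1).
  under eq_fun do rewrite mulr1; exact: (measurable_wrt_le gu (cF i iS)).
under eq_fun do rewrite mulr0; exact: wrt_cst.
Qed.

Lemma right_value_bounded S : simple_wf P W S ->
  exists C : R, forall u w, `|rv S u w| <= C.
Proof.
move=> [_ _ _ [M SM]]; exists (\sum_(i < simple_size S) M) => u w.
apply: (le_trans (ler_norm_sum _ _ _)); apply: ler_sum => i _.
have M0 : 0 <= M by apply: le_trans (SM i w _).
rewrite normrM; case: (_ && _); rewrite ?normr1 ?normr0 ?mulr1 ?mulr0//.
exact: SM.
Qed.

Let grid_nneg S i : simple_wf P W S -> 0 <= simple_grid S i.
Proof. by move=> [g0 ndg _ _]; apply: (le_trans g0); exact: ndg. Qed.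

(** The grid contains the jump times of [S] up to [t], so none is interior to a cell, and the value
    on the cell is the right limit at its left end. *)
Lemma simple_value_right S (p : nat -> R) n t j u w : simple_wf P W S ->
  grid p n t -> grid_covers p n t S -> (j < n)%N -> p j < u -> u <= p j.+1 ->
  simple_value S u w = rv S (p j) w.
Proof.
move=> wS g cS jn pju upj; apply: eq_bigr => i _; congr (_ * _).
have cmp k : (k <= simple_size S)%N -> p j < simple_grid S k -> p j.+1 <= simple_grid S k.
  move=> kS; apply: (grid_compat g) => //; first exact: grid_nneg.
  by move=> gt; exact: cS.
rewrite indicE mem_setE in_itv/=; congr (_%:R); congr nat_of_bool.
congr andb.
  apply/idP/idP => h; last exact: le_lt_trans h pju.
  rewrite leNgt; apply/negP => /cmp h'.
  by have := le_lt_trans (le_trans upj (h' (ltnW (ltn_ord i)))) h; rewrite ltxx.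
apply/idP/idP => h; first exact: lt_le_trans pju h.
by apply: (le_trans upj); exact: cmp.
Qed.

(** Each stopped value of [W] is telescoped over the grid by [grid_threshold]; the difference of the
    two thresholds that belong to one step of [S] is the indicator in [simple_right_value]. *)
Lemma simple_integral_grid S (p : nat -> R) n t w : simple_wf P W S ->
  grid p n t -> grid_covers p n t S ->
  simple_integral W S t w = dsum W p (fun i => rv S (p i)) n w.
Proof.
move=> wS g cS.
rewrite /dsum /simple_integral.
under [RHS]eq_bigr do rewrite /rv mulr_suml.
rewrite exchange_big/=; apply: eq_bigr => i _.
have gi k := @grid_nneg S k wS.
have cv k : (k <= simple_size S)%N -> simple_grid S k <= t -> covers p n (simple_grid S k).
  by move=> kS kt; exact: cS.
have -> : W (Num.min t (simple_grid S i.+1)) w - W (Num.min t (simple_grid S i)) w =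
  (W (Num.min t (simple_grid S i.+1)) w - W 0 w) -
  (W (Num.min t (simple_grid S i)) w - W 0 w) by ring.
rewrite -(grid_threshold (fun u => W u w) g (gi i.+1)) ?cv//; last by move=> h; exact: cv.
rewrite -(grid_threshold (fun u => W u w) g (gi i)); last by move=> h; apply: cv => //; exact: ltnW.
rewrite -sumrB mulr_sumr; apply: eq_bigr => j _.
rewrite -mulrBl mulrA; congr (_ * _ * _).
have gg : simple_grid S i <= simple_grid S i.+1 by case: wS => _ ndg _ _; exact: ndg.
have [h1|h1] := ltP (p j) (simple_grid S i) => /=.
  by rewrite (lt_le_trans h1 gg) subrr.
by rewrite subr0.
Qed.

Lemma simple_integral_gridj S (p : nat -> R) n t w j : simple_wf P W S ->
  grid p n t -> grid_covers p n t S -> (j <= n)%N ->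
  simple_integral W S (p j) w = dsum W p (fun i => rv S (p i)) j w.
Proof.
move=> wS g cS jn; apply: (simple_integral_grid _ wS (grid_trunc g jn)).
move=> i gi iS; apply: (covers_trunc g jn) => //; apply: cS => //.
by apply: (le_trans gi); case: (g) => _ <- _; exact: (grid_le g).
Qed.

Lemma simple_value_measurable S w : measurable_fun setT (fun u => simple_value S u w).
Proof.
apply: (@measurable_fun_sumr _ R R setT _ (fun i (u : R) => simple_coef S i w *
   \1_(`]simple_grid S i, simple_grid S i.+1]%classic) u)) => i.
by apply: measurable_funM => //; apply: measurable_indic; exact: measurable_itv.
Qed.

Local Notation leb := (@lebesgue_measure R).

(** On each cell [(x - y)^2 <= 2 ((x - z)^2 + (y - z)^2)], where [z] is the value of the common
    target [h]. The left side is the bracket of the difference of the two simple integrals. *)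
Lemma right_value_diff_le S S' (p : nat -> R) n t w (h : R -> R) (e e' : R) :
  simple_wf P W S -> simple_wf P W S' -> grid p n t ->
  grid_covers p n t S -> grid_covers p n t S' ->
  measurable_fun `[0, t]%classic h ->
  (\int[leb]_(u in `[0%R, t]) ((simple_value S u w - h u) ^+ 2)%:E <= e%:E)%E ->
  (\int[leb]_(u in `[0%R, t]) ((simple_value S' u w - h u) ^+ 2)%:E <= e'%:E)%E ->
  \sum_(j < n) (rv S (p j) w - rv S' (p j) w) ^+ 2 * (p j.+1 - p j) <= 2 * (e + e').
Proof.
move=> wS wS' g cS cS' mh Se Se'; rewrite -lee_fin.
have mt : measurable `[0, t]%classic by exact: measurable_itv.
have mS : measurable_fun `[0, t]%classic (fun u => ((simple_value S u w - h u) ^+ 2)%:E).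
  apply/measurable_EFinP; apply: measurable_funX; apply: measurable_funB => //.
  by apply: measurable_funTS; exact: simple_value_measurable.
have mS' : measurable_fun `[0, t]%classic (fun u => ((simple_value S' u w - h u) ^+ 2)%:E).
  apply/measurable_EFinP; apply: measurable_funX; apply: measurable_funB => //.
  by apply: measurable_funTS; exact: simple_value_measurable.
pose G u := (2%:E * (((simple_value S u w - h u) ^+ 2)%:E + ((simple_value S' u w - h u) ^+ 2)%:E))%E.
apply: (@le_trans _ _ (\int[leb]_(u in `[0%R, t]) G u)%E).
  apply: (grid_integral_ge (c := fun j => (rv S (p j) w - rv S' (p j) w) ^+ 2) g).
  - by apply: measurable_funeM; exact: emeasurable_funD.
  - by move=> u; rewrite /G -EFinD -EFinM lee_fin mulr_ge0// addr_ge0 ?sqr_ge0.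
  - by move=> i; exact: sqr_ge0.
  - move=> j u jn pu up; rewrite /G -EFinD -EFinM lee_fin.
    rewrite (simple_value_right _ wS g cS jn pu up) (simple_value_right _ wS' g cS' jn pu up).
    move: (rv S _ _) (rv S' _ _) (h u) => x y z.
    by have := sqr_ge0 ((x - z) + (y - z)); nra.
rewrite /G ge0_integralZl//; last 2 first.
- exact: emeasurable_funD.
- by move=> u _; rewrite -EFinD lee_fin addr_ge0 ?sqr_ge0.
rewrite ge0_integralD//; last 2 first.
- by move=> u _; rewrite lee_fin sqr_ge0.
- by move=> u _; rewrite lee_fin sqr_ge0.
by rewrite EFinM lee_wpmul2l// EFinD; apply: leeD.
Qed.

(** The weight [k] in [x^2 <= (1 + k) z^2 + (1 + 1/k) (x - z)^2] keeps the factor of [y] close to 1,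
    so that the final constant 4 survives the limit. *)
Lemma right_value_le S (p : nat -> R) n t w (h : R -> R) (e y k : R) : 0 < k ->
  simple_wf P W S -> grid p n t -> grid_covers p n t S ->
  measurable_fun `[0, t]%classic h ->
  (\int[leb]_(u in `[0%R, t]) ((simple_value S u w - h u) ^+ 2)%:E <= e%:E)%E ->
  (\int[leb]_(u in `[0%R, t]) ((h u) ^+ 2)%:E <= y%:E)%E ->
  \sum_(j < n) rv S (p j) w ^+ 2 * (p j.+1 - p j) <= (1 + k) * y + (1 + k^-1) * e.
Proof.
move=> k0 wS g cS mh Se hy; rewrite -lee_fin.
have mt : measurable `[0, t]%classic by exact: measurable_itv.
have mS : measurable_fun `[0, t]%classic (fun u => ((simple_value S u w - h u) ^+ 2)%:E).
  apply/measurable_EFinP; apply: measurable_funX; apply: measurable_funB => //.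
  by apply: measurable_funTS; exact: simple_value_measurable.
have mh2 : measurable_fun `[0, t]%classic (fun u => ((h u) ^+ 2)%:E).
  by apply/measurable_EFinP; apply: measurable_funX.
have k1 : 0 <= 1 + k^-1 by rewrite addr_ge0// invr_ge0 ltW.
have k2 : 0 <= 1 + k by rewrite addr_ge0// ltW.
pose G u := ((1 + k)%:E * ((h u) ^+ 2)%:E + (1 + k^-1)%:E * ((simple_value S u w - h u) ^+ 2)%:E)%E.
apply: (@le_trans _ _ (\int[leb]_(u in `[0%R, t]) G u)%E).
  apply: (grid_integral_ge (c := fun j => rv S (p j) w ^+ 2) g).
  - by apply: emeasurable_funD; exact: measurable_funeM.
  - move=> u; rewrite /G -!EFinM -EFinD lee_fin.
    by apply: addr_ge0; apply: mulr_ge0 => //; exact: sqr_ge0.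
  - by move=> i; exact: sqr_ge0.
  - move=> j u jn pu up; rewrite /G -!EFinM -EFinD lee_fin.
    rewrite (simple_value_right _ wS g cS jn pu up).
    move: (rv S _ _) (h u) => x z; rewrite -subr_ge0.
    have -> : (1 + k) * z ^+ 2 + (1 + k^-1) * (x - z) ^+ 2 - x ^+ 2 =
      k * (z - k^-1 * (x - z)) ^+ 2 by field; rewrite gt_eqF.
    by rewrite mulr_ge0 ?sqr_ge0// ltW.
rewrite /G ge0_integralD//; last 4 first.
- by move=> u _; rewrite -EFinM lee_fin mulr_ge0 ?sqr_ge0.
- exact: measurable_funeM.
- by move=> u _; rewrite -EFinM lee_fin mulr_ge0 ?sqr_ge0.
- exact: measurable_funeM.
rewrite !ge0_integralZl ?lee_fin//; last 2 first.
- by move=> u _; rewrite lee_fin sqr_ge0.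
- by move=> u _; rewrite lee_fin sqr_ge0.
rewrite [leRHS]EFinD [X in (_ <= X + _)%E]EFinM [X in (_ <= _ + X)%E]EFinM.
by apply: leeD; apply: lee_wpmul2l; rewrite ?lee_fin.
Qed.

End simple_processes.

(** * Convergence in probability of the simple integrals *)

Section truncation.
Context {R : realType}.
Variables (N : R) (u D : nat -> R).
Hypotheses (N0 : 0 <= N) (D0 : forall i, 0 <= D i).

(** The test includes cell [i] itself. This keeps the bracket at most [N] without overshoot, and the
    result is still known at the start of the cell, since the lengths [D] of the cells are
    deterministic. *)
Definition trunc (N : R) (u D : nat -> R) (i : nat) : R :=
  if \sum_(l < i.+1) u l ^+ 2 * D l <= N then u i else 0.

Let q i := \sum_(l < i) u l ^+ 2 * D l.

Let q_nd i j : (i <= j)%N -> q i <= q j.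
Proof.
apply: (homo_leq (r := fun x y => x <= y)) => //; first exact: le_trans.
by move=> k; rewrite /q big_ord_recr/= lerDl mulr_ge0 ?sqr_ge0.
Qed.

Lemma trunc_id n : q n <= N -> forall i, (i < n)%N -> trunc N u D i = u i.
Proof. by move=> qN i ni; rewrite /trunc (le_trans _ qN)//; exact: q_nd. Qed.

Lemma trunc_normr i : `|trunc N u D i| <= `|u i|.
Proof. by rewrite /trunc; case: ifPn => // _; rewrite normr0. Qed.

Lemma trunc_sum_le n : \sum_(i < n) trunc N u D i ^+ 2 * D i <= q n.
Proof.
apply: ler_sum => i _; rewrite ler_wpM2r//.
rewrite -(real_normK (num_real (u i))) -(real_normK (num_real (trunc _ _ _ _))).
by rewrite lerXn2r ?nnegrE//; exact: trunc_normr.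
Qed.

Let trunc_gt n i : N < q n -> (n <= i.+1)%N -> trunc N u D i = 0.
Proof. by move=> qN ni; rewrite /trunc leNgt (lt_le_trans qN)//; exact: q_nd. Qed.

Lemma trunc_sum_leN n : \sum_(i < n) trunc N u D i ^+ 2 * D i <= N.
Proof.
elim: n => [|n IH]; first by rewrite big_ord0.
have [h|h] := leP (q n.+1) N; first exact: le_trans (trunc_sum_le n.+1) h.
by rewrite big_ord_recr/= (trunc_gt h)// expr0n/= mul0r addr0.
Qed.

(** Truncation is stopping: brackets are nondecreasing, so once a term is killed all later ones are.
    Path bounds valid at all times thus pass to the truncated integral. *)
Lemma trunc_stopped (x : nat -> R) j : exists2 m, (m <= j)%N &
  \sum_(i < j) trunc N u D i * x i = \sum_(i < m) u i * x i.
Proof.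
elim: j => [|j [m mj E]]; first by exists 0%N; rewrite ?big_ord0.
have [h|h] := leP (q j.+1) N.
  exists j.+1 => //; apply: eq_bigr => i _; congr (_ * _).
  by apply: (trunc_id h).
exists m; first exact: leq_trans mj (leqnSn j).
by rewrite big_ord_recr/= (trunc_gt h)// mul0r addr0.
Qed.
End truncation.

Section holds_off.
Context {d : measure_display} {T : measurableType d} {R : realType}.
Variable P : probability T R.
Implicit Type Q : T -> Prop.

(** Replaces [P Q >= 1 - r] for path properties [Q] that need not be events; the exceptional event
    is measurable, and conjunctions add the bounds [r]. *)
Definition holds_off (r : R) Q :=
  exists E : set T, [/\ measurable E, (P E <= r%:E)%E & forall w, ~ E w -> Q w].

Lemma holds_off_and r1 r2 Q1 Q2 : holds_off r1 Q1 -> holds_off r2 Q2 ->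
  holds_off (r1 + r2) (fun w => Q1 w /\ Q2 w).
Proof.
move=> [E1 [m1 p1 h1]] [E2 [m2 p2 h2]]; exists (E1 `|` E2); split.
- exact: measurableU.
- by rewrite EFinD (le_trans (measureU2 _ m1 m2))// leeD.
- by move=> w E; split; [apply: h1|apply: h2] => Ew; apply: E; [left|right].
Qed.

Lemma holds_off_imp r Q1 Q2 : (forall w, Q1 w -> Q2 w) -> holds_off r Q1 -> holds_off r Q2.
Proof. by move=> h [E [mE pE hE]]; exists E; split => // w /hE/h. Qed.

Lemma holds_off_le r r' Q : r <= r' -> holds_off r Q -> holds_off r' Q.
Proof.
by move=> h [E [mE pE hE]]; exists E; split => //; rewrite (le_trans pE)// lee_fin.
Qed.

Lemma holds_off_ae Q : {ae P, forall w, Q w} -> holds_off 0 Q.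
Proof.
move=> [N [mN N0 QN]]; exists N; split => //; first by rewrite N0.
by move=> w Nw; apply: contrapT => Qw; apply: Nw; exact: QN.
Qed.

Lemma holds_off_seq (I : eqType) (s : seq I) (Q : I -> T -> Prop) (r : R) :
  0 <= r -> (forall i, i \in s -> holds_off r (Q i)) ->
  holds_off (r * (size s)%:R) (fun w => forall i, i \in s -> Q i w).
Proof.
move=> r0; elim: s => [|i s IH] h.
  exists set0; split => //; first by rewrite measure0 mulr0.
have := holds_off_and (h i (mem_head _ _)) (IH (fun j js => h j (mem_behead (s := i :: s) js))).
rewrite /= -[(size s).+1]addn1 natrD mulrDr mulr1 addrC.
apply: holds_off_imp => w [Qi Qs] j; rewrite inE => /predU1P[->//|]; exact: Qs.
Qed.

(** The outer measure is an infimum over countable measurable covers; the union of a nearly optimal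
    cover is the exceptional event. *)
Lemma cvg0_holds_off (D : nat -> T -> \bar R) : cvg0_in_probability P D ->
  forall e r : R, 0 < e -> 0 < r ->
  exists K, forall k, (K <= k)%N -> holds_off r (fun w => (D k w < e%:E)%E).
Proof.
move=> cD e r e0 r0.
have r0E : (0 < r%:E)%E by rewrite lte_fin.
have [K _ hK] := cD e e0 _ (open_ereal_lt' r0E).
exists K => k Kk; have /= := hK k Kk; rewrite /mu_ext => /ereal_inf_lt[_ [A [mA XA] <-] Ar].
exists (\bigcup_i A i); split.
- exact: bigcup_measurable.
- apply: le_trans (ltW Ar); apply: generalized_Boole_inequality => //.
  exact: bigcup_measurable.
- by move=> w Ew; rewrite ltNge; apply/negP => /XA.
Qed.

Lemma markov_sqr (f : T -> R) (e r : R) : 0 < e -> L2 P f ->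
  Ex P (fun w => f w ^+ 2) <= r -> holds_off (r / e ^+ 2) (fun w => f w < e).
Proof.
move=> e0 fL fr.
have mE : measurable [set w | e <= f w].
  rewrite -[X in measurable X]setTI.
  exact: (@measurable_fun_ler _ _ _ setT (fun=> e) f _ fL.1 measurableT [set true]).
exists [set w | e <= f w]; split => //; last by move=> w /= /negP; rewrite -ltNge.
rewrite -Ex_indic// lee_fin ler_pdivlMr ?exprn_gt0// mulrC -Ex_scale; last exact: L1_indic.
apply: le_trans fr; apply: Ex_le; [exact/L1_scale/L1_indic|exact: fL.2|].
move=> w; rewrite indicE; case: (boolP (w \in _)) => [|_]; last by rewrite mulr0 sqr_ge0.
rewrite inE/= mulr1 => h.
by rewrite lerXn2r// nnegrE ltW// (lt_le_trans e0).
Qed.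
End holds_off.

(** * One approximating sequence for all times of an interval *)

Section ito.
Context {d : measure_display} {T : measurableType d} {R : realType}.
Variables (P : probability T R) (W : R -> T -> R).
Hypothesis HW : wiener_process P W.
Local Notation F := (augmented_filtration P W).
Local Notation leb := (@lebesgue_measure R).
Local Notation SI := (simple_integral W).
Local Notation rv := simple_right_value.

Lemma trunc_adapted (p : nat -> R) (v : nat -> T -> R) (N : R) :
  (forall i, p i <= p i.+1) -> (forall i, measurable_wrt (F (p i)) (v i)) ->
  forall i, measurable_wrt (F (p i))
    (fun w => trunc N (fun l => v l w) (fun l => p l.+1 - p l) i).
Proof.
move=> nd vF i; apply: wrt_if => //; try exact: wrt_cst.
apply: (@wrt_sum _ _ _ P W (p i) i.+1 (fun l w => v l w ^+ 2 * (p l.+1 - p l))) => l li.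
have vl : measurable_wrt (F (p i)) (v l).
  apply: measurable_wrt_le (vF l); apply: (homo_leq (r := fun x y => x <= y)) => //.
  exact: le_trans.
by apply: wrt_mul; [exact: wrt_mul|exact: wrt_cst].
Qed.

Definition simple_times (S : @simple_process d T R) : seq R :=
  [seq simple_grid S i | i <- iota 0 (simple_size S).+1].

Lemma simple_times_covers S (p : nat -> R) n t : simple_wf P W S ->
  (forall x, x \in simple_times S -> 0 <= x -> x <= t -> covers p n x) ->
  grid_covers p n t S.
Proof.
move=> [g0 ndg _ _] h i it iS; apply: h => //.
  by apply/mapP; exists i => //; rewrite mem_iota/= add0n ltnS.
by apply: (le_trans g0); exact: ndg.
Qed.

(* The difference of the two integrals, stopped when its bracket exceeds [e],
   is a martingale with bracket at most [e]. *)
Lemma simple_integral_diff_small S S' (t e r eta : R) (L : seq R) :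
  simple_wf P W S -> simple_wf P W S' -> 0 <= t -> 0 < e -> 0 < r ->
  {in L, forall s, 0 <= s <= t} ->
  holds_off P eta (fun w => exists h : R -> R, [/\ measurable_fun `[0, t]%classic h,
   (\int[leb]_(u in `[0%R, t]) ((simple_value S u w - h u) ^+ 2)%:E <= (e / 4)%:E)%E &
   (\int[leb]_(u in `[0%R, t]) ((simple_value S' u w - h u) ^+ 2)%:E <= (e / 4)%:E)%E]) ->
  holds_off P (eta + (4 * e) / r ^+ 2)
    (fun w => {in L, forall s, `|SI S s w - SI S' s w| < r}).
Proof.
move=> wS wS' t0 e0 r0 Lt hoff.
have [p [n [g cov]]] := grid_exists (L ++ simple_times S ++ simple_times S') t0.
have cS : grid_covers p n t S.
  by apply: simple_times_covers => // x xS; apply: cov; rewrite !mem_cat xS orbT.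
have cS' : grid_covers p n t S'.
  by apply: simple_times_covers => // x xS; apply: cov; rewrite !mem_cat xS !orbT.
have cL s : s \in L -> covers p n s.
  by move=> sL; have /andP[? ?] := Lt s sL; apply: cov; rewrite ?mem_cat ?sL.
have [p0 pn nd] := g.
pose u i w := rv S (p i) w - rv S' (p i) w.
have uF i : measurable_wrt (F (p i)) (u i).
  by apply: wrt_sub; exact: right_value_adapted.
have [C hC] := right_value_bounded wS; have [C' hC'] := right_value_bounded wS'.
have D0 i : 0 <= p i.+1 - p i by rewrite subr_ge0.
pose v i w := trunc e (fun l => u l w) (fun l => p l.+1 - p l) i.
have vF : forall i, measurable_wrt (F (p i)) (v i) by exact: trunc_adapted.
have vC i w : `|v i w| <= C + C'.
  apply: (le_trans (trunc_normr _ _ _ _)); apply: (le_trans (ler_normB _ _)).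
  exact: lerD.
have p00 : 0 <= p 0%N by rewrite p0.
have dd := dsum_doob HW p00 nd vF vC n.
have le4 : Ex P (fun w => mmax W p v n w ^+ 2) <= 4 * e.
  apply: (le_trans dd); rewrite ler_wpM2l//.
  have -> : e = Ex P (fun=> e) by rewrite Ex_cst.
  apply: Ex_le; [|exact: L1_cst|by move=> w; exact: trunc_sum_leN (ltW e0) D0 n].
  apply: (L1_le _ _ (L1_cst P e)).
    apply: (@measurable_fun_sumr _ _ _ _ _ (fun i w => v i w ^+ 2 * (p i.+1 - p i))) => i.
    apply: measurable_funM => //; apply: measurable_funX.
    exact: (measurable_wrt_measurable HW (vF i)).
  move=> w; rewrite ger0_norm; first exact: trunc_sum_leN (ltW e0) D0 n.
  by apply: sumr_ge0 => i _; rewrite mulr_ge0 ?sqr_ge0.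
have off2 := markov_sqr r0 (mmax_L2 HW p00 nd vF vC n) le4.
apply: (holds_off_imp _ (holds_off_and hoff off2)) => w [[h [mh h1 h2]] mr] s sL.
have [k kn <-] := cL s sL.
(* The bracket is at most [2 (e/4 + e/4) = e] here, so the truncation at level [e] is inactive. *)
have ue := right_value_diff_le wS wS' g cS cS' mh h1 h2.
rewrite (simple_integral_gridj _ wS g cS kn) (simple_integral_gridj _ wS' g cS' kn).
apply: le_lt_trans mr.
suff -> : dsum W p (fun i => rv S (p i)) k w - dsum W p (fun i => rv S' (p i)) k w =
    dsum W p v k w by exact: (running_max_ge (fun j => dsum W p v j w) kn).
rewrite /dsum -sumrB; apply: eq_bigr => i _; rewrite -mulrBl; congr (_ * _).
rewrite /v (@trunc_id _ _ (fun l => u l w) (fun l => p l.+1 - p l) D0 n)//; last first.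
  exact: leq_trans (ltn_ord i) kn.
by apply: (le_trans ue); lra.
Qed.

Variables (H I : R -> T -> R).
Hypothesis mH : {ae P, forall w, forall t : R, 0 <= t -> measurable_fun `[0, t]%classic (H ^~ w)}.
Hypothesis HI : forall t : R, 0 <= t -> ito_integral P W H t (I t).

Let mHoff (t : R) : 0 <= t -> holds_off P 0 (fun w => measurable_fun `[0, t]%classic (H ^~ w)).
Proof. by move=> t0; apply: holds_off_imp (holds_off_ae mH) => w; exact. Qed.

Definition approx_seq t (S : nat -> @simple_process d T R) :=
  [/\ forall k, simple_wf P W (S k),
      forall e r : R, 0 < e -> 0 < r -> exists K, forall k, (K <= k)%N -> holds_off P r
        (fun w => (\int[leb]_(u in `[0%R, t]) ((simple_value (S k) u w - H u w) ^+ 2)%:E < e%:E)%E) &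
      forall e r : R, 0 < e -> 0 < r -> exists K, forall k, (K <= k)%N -> holds_off P r
        (fun w => `|SI (S k) t w - I t w| < e)].

Lemma approx_seq_exists t : 0 <= t -> exists S, approx_seq t S.
Proof.
move=> t0; have [S [wS c1 c2]] := HI t0; exists S; split => //.
  by move=> e r e0 r0; exact: cvg0_holds_off c1 e r e0 r0.
move=> e r e0 r0; have [K hK] := cvg0_holds_off c2 e0 r0; exists K => k Kk.
by apply: holds_off_imp (hK k Kk) => w; rewrite lte_fin.
Qed.

Lemma integral_itv_le (f : R -> R) (s t : R) : s <= t -> measurable_fun `[0, t]%classic f ->
  (\int[leb]_(u in `[0%R, s]) ((f u) ^+ 2)%:E <= \int[leb]_(u in `[0%R, t]) ((f u) ^+ 2)%:E)%E.
Proof.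
move=> st mf; apply: ge0_subset_integral => //; try exact: measurable_itv.
- by apply/measurable_EFinP; exact: measurable_funX.
- by move=> u _; rewrite lee_fin sqr_ge0.
- by move=> u /=; rewrite !in_itv/= => /andP[-> h]; rewrite (le_trans h).
Qed.

(** The definition of the integral at time [s] provides its own sequence [S']. Both [S] and [S']
    approximate [H] in L2 on [[0, s]], so their simple integrals at [s] are close by
    [simple_integral_diff_small], and the second is close to [I s]. *)
Lemma approx_seq_inner t S s : approx_seq t S -> 0 <= s <= t ->
  forall e r : R, 0 < e -> 0 < r -> exists K, forall k, (K <= k)%N -> holds_off P r
        (fun w => `|SI (S k) s w - I s w| < e).
Proof.
move=> [wS c1 _] /andP[s0 st] e r e0 r0.
have [S' [wS' c1' c2']] := approx_seq_exists s0.
have t0 := le_trans s0 st.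
(* Solves [4 e' / (e / 2)^2 = r / 8], the probability lost to Doob and Chebyshev. *)
pose e' := (r / 8) * (e / 2) ^+ 2 / 4.
have e'0 : 0 < e' by rewrite /e' !divr_gt0 ?mulr_gt0 ?exprn_gt0 ?divr_gt0.
have e4 : 0 < e' / 4 by rewrite divr_gt0.
have e2 : 0 < e / 2 by rewrite divr_gt0.
have r8 : 0 < r / 8 by rewrite divr_gt0.
have [K1 h1] := c1 _ _ e4 r8; have [K2 h2] := c1' _ _ e4 r8; have [K3 h3] := c2' _ _ e2 r8.
exists K1 => k Kk.
pose l := maxn K2 K3.
have o1 := h1 k Kk; have o2 := h2 l (leq_maxl _ _); have o3 := h3 l (leq_maxr _ _).
have o := holds_off_and (mHoff t0) (holds_off_and o1 o2).
have : holds_off P (0 + (r / 8 + r / 8)) (fun w => exists h : R -> R, [/\ measurable_fun `[0, s]%classic h,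
   (\int[leb]_(u in `[0%R, s]) ((simple_value (S k) u w - h u) ^+ 2)%:E <= (e' / 4)%:E)%E &
   (\int[leb]_(u in `[0%R, s]) ((simple_value (S' l) u w - h u) ^+ 2)%:E <= (e' / 4)%:E)%E]).
  apply: holds_off_imp o => w [mh [a b]]; exists (H ^~ w); split.
  - apply: (measurable_funS _ _ mh); first exact: measurable_itv.
    by move=> u /=; rewrite !in_itv/= => /andP[-> h]; rewrite (le_trans h).
  - apply: (le_trans _ (ltW a)).
    apply: (@integral_itv_le (fun u => simple_value (S k) u w - H u w)) => //.
    apply: measurable_funB => //; apply: measurable_funTS; exact: simple_value_measurable.
  - exact: ltW.
have Ls : {in [:: s], forall s', 0 <= s' <= s} by move=> s'; rewrite inE => /eqP ->; rewrite s0 lexx.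
move=> /(simple_integral_diff_small (wS k) (wS' l) s0 e'0 e2 Ls) o4.
apply: holds_off_le (holds_off_imp _ (holds_off_and o3 o4)); last first.
  move=> w [a b]; have b' := b s (mem_head _ _).
  apply: (le_lt_trans (ler_distD (SI (S' l) s w) _ _)).
  by rewrite (splitr e) ltrD.
have -> : 4 * e' / (e / 2) ^+ 2 = r / 8 by rewrite /e'; field; rewrite gt_eqF.
lra.
Qed.

(** [K] is chosen before [L], because later [L] consists of grid points built from the jump times of
    [S k]. For this, [S k] is compared with [S l], where [l] depends on [L]: Doob controls their
    difference on all of [L] at a cost independent of [L], and [S l] is close to [I] at each of the
    finitely many times. *)
Lemma approx_seq_uniform t S : 0 <= t -> approx_seq t S ->
  forall e r : R, 0 < e -> 0 < r -> exists K, forall k, (K <= k)%N ->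
    forall L : seq R, {in L, forall s, 0 <= s <= t} -> holds_off P r
        (fun w => {in L, forall s, `|SI (S k) s w - I s w| < e}).
Proof.
move=> t0 aS e r e0 r0; have [wS c1 _] := aS.
pose e' := (r / 8) * (e / 2) ^+ 2 / 4.
have e'0 : 0 < e' by rewrite /e' !divr_gt0 ?mulr_gt0 ?exprn_gt0 ?divr_gt0.
have e4 : 0 < e' / 4 by rewrite divr_gt0.
have e2 : 0 < e / 2 by rewrite divr_gt0.
have r8 : 0 < r / 8 by rewrite divr_gt0.
have [K1 h1] := c1 _ _ e4 r8; exists K1 => k Kk L Lt.
(* The share of each time of [L] in a union bound; the successor avoids division by 0 for empty
   [L]. *)
pose r' := r / 8 / (size L).+1%:R.
have r'0 : 0 < r' by rewrite divr_gt0.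
have /choice[K2 hK2] : forall s, exists K, s \in L -> forall l, (K <= l)%N -> holds_off P r'
   (fun w => `|SI (S l) s w - I s w| < e / 2).
  move=> s; have [sL|] := boolP (s \in L); last by exists 0%N.
  by have [K hK] := approx_seq_inner aS (Lt s sL) e2 r'0; exists K.
pose l := maxn K1 (\max_(s <- L) K2 s).
have o3 : holds_off P (r' * (size L)%:R) (fun w => forall s, s \in L -> `|SI (S l) s w - I s w| < e / 2).
  apply: holds_off_seq => [|s sL]; first exact: ltW.
  apply: hK2 => //; apply: leq_trans (leq_maxr _ _).
  by rewrite (big_rem s sL)/= leq_maxl.
have o1 := h1 k Kk; have o2 := h1 l (leq_maxl _ _).
have o := holds_off_and (mHoff t0) (holds_off_and o1 o2).
have : holds_off P (0 + (r / 8 + r / 8)) (fun w => exists h : R -> R, [/\ measurable_fun `[0, t]%classic h,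
   (\int[leb]_(u in `[0%R, t]) ((simple_value (S k) u w - h u) ^+ 2)%:E <= (e' / 4)%:E)%E &
   (\int[leb]_(u in `[0%R, t]) ((simple_value (S l) u w - h u) ^+ 2)%:E <= (e' / 4)%:E)%E]).
  by apply: holds_off_imp o => w [mh [a b]]; exists (H ^~ w); split => //; exact: ltW.
move=> /(simple_integral_diff_small (wS k) (wS l) t0 e'0 e2 Lt) o4.
apply: holds_off_le (holds_off_imp _ (holds_off_and o3 o4)); last first.
  move=> w [a b] s sL; have b' := b s sL; have a' := a s sL.
  apply: (le_lt_trans (ler_distD (SI (S l) s w) _ _)).
  by rewrite (splitr e) ltrD.
have -> : 4 * e' / (e / 2) ^+ 2 = r / 8 by rewrite /e'; field; rewrite gt_eqF.
have : r' * (size L)%:R <= r / 8.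
  by rewrite /r' mulrAC ler_pdivrMr// ler_wpM2l ?ler_nat// ltW.
lra.
Qed.

End ito.

(** * Approximation of the Ito integral by bounded-bracket martingales on grids *)

Section approximation.
Context {d : measure_display} {T : measurableType d} {R : realType}.
Variables (P : probability T R) (W : R -> T -> R).
Hypothesis HW : wiener_process P W.
Local Notation F := (augmented_filtration P W).
Local Notation leb := (@lebesgue_measure R).
Local Notation SI := (simple_integral W).
Local Notation rv := simple_right_value.
Variables (H I : R -> T -> R).
Hypothesis mH : {ae P, forall w, forall t : R, 0 <= t -> measurable_fun `[0, t]%classic (H ^~ w)}.
Hypothesis HI : forall t : R, 0 <= t -> ito_integral P W H t (I t).

(** In [approx_off], the first clause controls the bracket by the integral of [H^2]. The second
    matches [I] at prescribed times, with [t] at the last index, where that integral is small enough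
    for the truncation to be inactive. The third holds even after truncation, which moves the
    matching time back, and carries lower bounds of [I] over to the martingale. The bound [y] is
    quantified so as to cover paths where the integral of [H^2] is infinite. *)
Record martingale_approximation (t N e r : R) (L : seq R) (p : nat -> R) (n : nat)
    (v : nat -> T -> R) : Prop := MartingaleApproximation {
  approx_grid : grid p n t ;
  approx_adapted : forall i, measurable_wrt (F (p i)) (v i) ;
  approx_bounded : exists C : R, forall i w, `|v i w| <= C ;
  approx_bracket : forall w, \sum_(i < n) v i w ^+ 2 * (p i.+1 - p i) <= N ;
  approx_off : holds_off P r (fun w =>
    [/\ forall y, (\int[leb]_(u in `[0%R, t]) ((H u w) ^+ 2)%:E <= y%:E)%E ->
          \sum_(i < n) v i w ^+ 2 * (p i.+1 - p i) <= (1 + e) * y + e,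
        forall y, (\int[leb]_(u in `[0%R, t]) ((H u w) ^+ 2)%:E <= y%:E)%E ->
          (1 + e) * y + e <= N -> forall s, s \in t :: L ->
          exists2 j, (j <= n)%N & (s = t -> j = n) /\ `|dsum W p v j w - I s w| <= e &
        forall j, (j <= n)%N -> exists2 s, 0 <= s <= t & `|dsum W p v j w - I s w| <= e]) }.

Lemma martingale_approximation_exists (t N e r : R) (L : seq R) :
  0 <= t -> 0 <= N -> 0 < e -> 0 < r -> {in L, forall s, 0 <= s <= t} ->
  exists p n v, martingale_approximation t N e r L p n v.
Proof.
move=> t0 N0 e0 r0 Lt.
have [S aS] := approx_seq_exists HI t0; have [wSs c1 _] := aS.
(* Makes the error [(1 + 1/e) e'] of [right_value_le], taken with weight [k = e], equal to [e]. *)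
pose e' := e / (1 + e^-1).
have ei : 0 < 1 + e^-1 by rewrite addr_gt0// invr_gt0.
have e'0 : 0 < e' by rewrite divr_gt0.
have r2 : 0 < r / 2 by rewrite divr_gt0.
have [K1 h1] := c1 _ _ e'0 r2.
have [K2 h2] := approx_seq_uniform HW mH HI t0 aS e0 r2.
pose k := maxn K1 K2.
have o1 := h1 k (leq_maxl _ _); have wS := wSs k.
have [p [n [g cov]]] := grid_exists (L ++ simple_times (S k)) t0.
have cS : grid_covers p n t (S k).
  by apply: simple_times_covers => // x xS; apply: cov; rewrite !mem_cat xS orbT.
have [p0 pn nd] := g.
have pt j : (j <= n)%N -> 0 <= p j <= t.
  by move=> jn; rewrite (grid_ge0 j g) -pn (grid_le g).
have o2 : holds_off P (r / 2) (fun w => forall j, (j <= n)%N -> `|SI (S k) (p j) w - I (p j) w| < e).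
  apply: holds_off_imp (h2 k (leq_maxr _ _) [seq p j | j <- iota 0 n.+1] _).
    move=> w h j jn; apply: h; apply/mapP; exists j => //.
    by rewrite mem_iota/= add0n ltnS.
  move=> s /mapP[j]; rewrite mem_iota/= add0n ltnS => jn ->; exact: pt.
have D0 i : 0 <= p i.+1 - p i by rewrite subr_ge0.
pose u i w := rv (S k) (p i) w.
pose v i w := trunc N (fun l => u l w) (fun l => p l.+1 - p l) i.
have uF i : measurable_wrt (F (p i)) (u i) by exact: right_value_adapted.
have [C hC] := right_value_bounded wS.
have uE j w : (j <= n)%N -> SI (S k) (p j) w = dsum W p u j w.
  by move=> jn; rewrite (simple_integral_gridj _ wS g cS jn).
exists p, n, v; split => //.
- exact: trunc_adapted.
- by exists C => i w; apply: (le_trans (trunc_normr _ _ _ _)); exact: hC.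
- by move=> w; exact: trunc_sum_leN.
have o := holds_off_and (holds_off_imp _ (holds_off_ae mH)) (holds_off_and o1 o2).
apply: holds_off_le (holds_off_imp _ (o (fun w => measurable_fun `[0, t]%classic (H ^~ w)) _)).
- by lra.
- move=> w [mh [/ltW hS hI]].
  have le_sum y : (\int[leb]_(u in `[0%R, t]) ((H u w) ^+ 2)%:E <= y%:E)%E ->
      \sum_(i < n) u i w ^+ 2 * (p i.+1 - p i) <= (1 + e) * y + e.
    move=> hy; apply: (le_trans (right_value_le e0 wS g cS mh hS hy)).
    by rewrite lerD2l /e' mulrC divfK// gt_eqF.
  have tr := trunc_sum_le N (fun l => u l w) D0.
  split.
  + by move=> y hy; apply: (le_trans (tr n)); exact: le_sum.
  + move=> y hy yN s sL.
    have [j jn [sn ps]] : exists2 j, (j <= n)%N & (s = t -> j = n) /\ p j = s.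
      have [->|st] := eqVneq s t; first by exists n.
      move: sL; rewrite inE (negbTE st)/= => sL.
      have /andP[? ?] := Lt s sL.
      have [j jn pj] : covers p n s by apply: cov => //; rewrite mem_cat sL.
      by exists j => //; split => // h; rewrite h eqxx in st.
    exists j => //; split=> //; rewrite -ps.
    have -> : dsum W p v j w = dsum W p u j w.
      apply: eq_bigr => i _; congr (_ * _).
      apply: (@trunc_id _ N (fun l => u l w) (fun l => p l.+1 - p l) D0 n).
        exact: le_trans (le_sum _ hy) yN.
      exact: leq_trans (ltn_ord i) jn.
    by rewrite -uE// ltW// hI.
  + move=> j jn.
    have [m mj E] := @trunc_stopped _ N (fun l => u l w) (fun l => p l.+1 - p l) D0
      (fun i => W (p i.+1) w - W (p i) w) j.
    have mn := leq_trans mj jn.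
    exists (p m); first exact: pt.
    by rewrite [dsum _ _ _ _ _]E -[X in `|X - _|]/(dsum W p u m w) -uE// ltW// hI.
- by move=> w; exact.
Qed.

End approximation.

(** * Moment bounds for the Ito integral *)

Lemma le_eps_scale (R : realType) (x y K : R) : 0 <= K ->
  (forall e, 0 < e -> e <= 1 -> x <= y + K * e) -> x <= y.
Proof.
move=> K0 h; apply/ler_addgt0Pr => e e0.
pose e' := Num.min 1 (e / (K + 1)).
have K1 : 0 < K + 1 by rewrite ltr_wpDl.
have e'0 : 0 < e' by rewrite lt_min ltr01 divr_gt0.
have e'1 : e' <= 1 by rewrite ge_min lexx.
apply: (le_trans (h e' e'0 e'1)); rewrite lerD2l.
have : e' <= e / (K + 1) by rewrite ge_min lexx orbT.
rewrite ler_pdivlMr// => le; apply: le_trans le.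
by rewrite mulrC ler_wpM2l ?lerDl// ltW.
Qed.

Section estimates.
Context {d : measure_display} {T : measurableType d} {R : realType}.
Variables (P : probability T R) (W : R -> T -> R).
Hypothesis HW : wiener_process P W.
Local Notation F := (augmented_filtration P W).
Local Notation leb := (@lebesgue_measure R).
Variables (H I : R -> T -> R).
Hypothesis mH : {ae P, forall w, forall t : R, 0 <= t -> measurable_fun `[0, t]%classic (H ^~ w)}.
Hypothesis HI : forall t : R, 0 <= t -> ito_integral P W H t (I t).
Hypothesis mI : forall t : R, 0 <= t -> measurable_fun setT (I t).

Section truncated_limit.
Variables (X Y : T -> R) (B : R).
Hypotheses (mX : measurable_fun setT X) (X0 : forall w, 0 <= X w)
  (mY : measurable_fun setT Y).

(** Where [Y <= m] a fixed truncation level makes the approximation exact, and the bound [m] makes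
    an exceptional event cost at most [m] times its probability. *)
Definition cutoff (m : nat) (w : T) : R :=
  if Y w <= m%:R then Num.min (X w) m%:R else 0.

Lemma cutoff_ge0 m w : 0 <= cutoff m w.
Proof. by rewrite /cutoff; case: ifPn => // _; rewrite le_min X0/=. Qed.

Lemma cutoff_le m w : cutoff m w <= m%:R.
Proof. by rewrite /cutoff; case: ifPn => // _; rewrite ge_min lexx orbT. Qed.

Lemma cutoff_measurable m : measurable_fun setT (cutoff m).
Proof.
apply: measurable_fun_ifT => //; first exact: measurable_fun_ler.
exact: measurable_minr.
Qed.

Lemma cutoff_L1 m : L1 P (cutoff m).
Proof.
apply: (L1_le (cutoff_measurable m) _ (L1_cst P m%:R)) => w.
by rewrite ger0_norm ?cutoff_ge0// cutoff_le.
Qed.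

Lemma integral_le_cutoff : (forall m, Ex P (cutoff m) <= B) ->
  (\int[P]_w (X w)%:E <= B%:E)%E.
Proof.
move=> hB; apply: (@fatou_bound _ _ _ P (fun m w => (cutoff m w)%:E)).
- by move=> m; apply/measurable_EFinP; exact: cutoff_measurable.
- by move=> m w; rewrite lee_fin cutoff_ge0.
- by move=> m; rewrite -Ex_EFin ?lee_fin//; exact: cutoff_L1.
move=> w; apply: cvg_near_cst.
have [k hk] : exists k : nat, `|X w| + `|Y w| <= k%:R.
  by exists (Num.bound (`|X w| + `|Y w|)); apply/ltW/archi_boundP; rewrite addr_ge0.
exists k => // n /= kn; rewrite /cutoff.
have hn : `|X w| + `|Y w| <= n%:R by apply: le_trans hk _; rewrite ler_nat.
have Xn := ler_norm (X w); have Yn := ler_norm (Y w).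
have X1 := normr_ge0 (X w); have Y1 := normr_ge0 (Y w).
rewrite ifT; last by lra.
by rewrite (min_idPl _)//; lra.
Qed.
End truncated_limit.

Lemma bracket_le_nat (e : R) (m : nat) (y : R) : 0 < e -> e <= 1 -> y <= m%:R ->
  0 <= y -> (1 + e) * y + e <= 2 * m%:R + 1.
Proof.
move=> e0 e1 ym y0; have m0 : 0 <= m%:R :> R by []. nra.
Qed.

(** A local martingale bounded below is a supermartingale, here with initial value 0. Off a small
    event the cut-off variable is at most [M + c + e], where [M] is a martingale value of mean 0; on
    that event it is at most [m], and the bound on [E M^2] controls what [M] loses there. *)
Lemma supermartingale_bound (t c : R) (Y : T -> R) : 0 <= t -> 0 <= c ->
  measurable_fun setT Y -> (forall w, 0 <= Y w) ->
  {ae P, forall w, (\int[leb]_(u in `[0%R, t]) ((H u w) ^+ 2)%:E <= (Y w)%:E)%E} ->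
  {ae P, forall w, forall s, 0 <= s <= t -> - c <= I s w} ->
  (\int[P]_w (Num.max (I t w + c) 0)%:E <= c%:E)%E.
Proof.
move=> t0 c0 mY Y0 HY Ic.
have mIc : measurable_fun setT (fun w => Num.max (I t w + c) 0).
  by apply: measurable_maxr => //; apply: measurable_funD => //; exact: mI.
apply: (integral_le_cutoff mIc _ mY) => [w|m]; first by rewrite le_max lexx orbT.
apply: (@le_eps_scale _ _ _ 2) => // e e0 e1.
(* Dominates [(1 + e) Y + e] when [Y <= m] and [e <= 1], so the truncation is inactive where the
   cutoff is nonzero. *)
set N : R := 2 * m%:R + 1.
have N0 : 0 <= N by rewrite addr_ge0// mulr_ge0.
(* The exceptional event has probability at most [r^2]; the errors [r (N + 1)] from
   [Ex_mul_indic_le] and [m r^2 <= m r] then add up to at most [e]. *)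
pose r := e / (N + 1 + m%:R).
have d0 : 0 < N + 1 + m%:R by rewrite ltr_pwDl// ltr_wpDl.
have r0 : 0 < r by rewrite divr_gt0.
have rd : r * (N + 1 + m%:R) = e by rewrite /r divfK// gt_eqF.
have r1 : r <= 1.
  rewrite /r ler_pdivrMr// mul1r (le_trans e1)//.
  have : 0 <= m%:R :> R by []. lra.
have r20 : 0 < r ^+ 2 by rewrite exprn_gt0.
have Lt : {in [::] : seq R, forall s, 0 <= s <= t} by [].
have [p [n [v A]]] := martingale_approximation_exists HW mH HI t0 N0 e0 r20 Lt.
have [E [mE PE hE]] := holds_off_and (approx_off A) (holds_off_and (holds_off_ae HY) (holds_off_ae Ic)).
have [g vF [C vC] br _] := A; have [p0 pn nd] := g.
have p00 : 0 <= p 0%N by rewrite p0.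
pose M w := dsum W p v n w.
have ML : L2 P M by exact: (dsum_L2 HW p00 nd vF vC).
have M0 : Ex P M = 0 by exact: (dsum_Ex HW p00 nd vF vC).
have D0 i : 0 <= p i.+1 - p i by rewrite subr_ge0.
have MN : Ex P (fun w => M w ^+ 2) <= N.
  apply: (le_trans (dsum_Ex2 HW p00 nd vF vC n)).
  have -> : N = Ex P (fun=> N) by rewrite Ex_cst.
  apply: Ex_le => //; last exact: L1_cst.
  apply: (L1_le _ _ (L1_cst P N)).
    apply: (@measurable_fun_sumr _ _ _ _ _ (fun i w => v i w ^+ 2 * (p i.+1 - p i))) => i.
    apply: measurable_funM => //; apply: measurable_funX.
    exact: (measurable_wrt_measurable HW (vF i)).
  move=> w; rewrite ger0_norm//.
  by apply: sumr_ge0 => i _; rewrite mulr_ge0 ?sqr_ge0.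
have PE' : Ex P (\1_E) <= r ^+ 2.
  by rewrite -lee_fin Ex_indic// (le_trans PE)// lee_fin !addr0.
have EL : L2 P (\1_E : T -> R).
  apply: (@L2_le _ _ _ _ _ (fun=> 1) _ _ (L2_cst P 1)) => //.
  by move=> w; rewrite indicE; case: (_ \in _); rewrite ?normr1 ?normr0.
have := Ex_mul_indic_le mE ML MN r0 PE'; rewrite ler_norml => /andP[ME1 _].
have i1 := L2_L1 ML; have i2 := L2_mulL1 ML EL; have i3 := L1_scale m%:R (L1_indic P mE).
have i4 : L1 P (fun w => M w + (c + e)) by apply: L1_add => //; exact: L1_cst.
have i5 : L1 P (fun w => m%:R * \1_E w - M w * \1_E w) by exact: L1_sub.
apply: (@le_trans _ _ (Ex P (fun w => (M w + (c + e)) + (m%:R * \1_E w - M w * \1_E w)))).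
  apply: Ex_le.
  - apply: cutoff_L1 => // w; first by rewrite le_max lexx orbT.
  - exact: L1_add.
  move=> w; rewrite indicE; have [wE|wE] := boolP (w \in E).
    rewrite !mulr1; apply: (le_trans (cutoff_le _ _ _ _)); lra.
  rewrite !mulr0 subr0 addr0.
  have [[_ A2 A3] [Yw Iw]] : _ := hE w (fun h => negP wE (mem_set h)).
  (* Even where [Y] is large and the martingale has been stopped, it is near [I] at some time, hence
     at least [- c - e]. This makes the bound valid where the cutoff vanishes. *)
  have [s st sI] := A3 n (leqnn n).
  have := Iw s st; move: sI; rewrite ler_norml => /andP[s1 s2] Is.
  have Mlow : 0 <= M w + (c + e) by rewrite /M; lra.
  rewrite /cutoff; case: ifPn => [Ym|//].
  rewrite ge_min; apply/orP; left; rewrite ge_max Mlow andbT.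
  have [j _ [jn]] := A2 (Y w) Yw (bracket_le_nat e0 e1 Ym (Y0 w)) t (mem_head _ _).
  by rewrite jn// ler_norml => /andP[]; rewrite /M; lra.
rewrite (Ex_add i4 i5) (Ex_add i1 (L1_cst P _)) (Ex_sub i3 i2) (Ex_scale _ (L1_indic P mE)).
rewrite M0 Ex_cst add0r.
have : m%:R * Ex P (\1_E) <= m%:R * r.
  rewrite ler_wpM2l//; apply: (le_trans PE').
  by rewrite expr2 -[leRHS]mulr1 ler_wpM2l// ltW.
move: rd ME1; rewrite !mulrDr; lra.
Qed.

Fixpoint max_sqr (L : seq R) (w : T) : R :=
  if L is s :: L' then Num.max (I s w ^+ 2) (max_sqr L' w) else 0.

Lemma max_sqr_ge0 L w : 0 <= max_sqr L w.
Proof. by case: L => //= s L; rewrite le_max sqr_ge0. Qed.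

Lemma max_sqr_ge L w s : s \in L -> I s w ^+ 2 <= max_sqr L w.
Proof.
elim: L => //= s' L IH; rewrite inE le_max => /predU1P[->|/IH ->]; last by rewrite orbT.
by rewrite lexx.
Qed.

Lemma max_sqr_le L w (B : R) : 0 <= B -> (forall s, s \in L -> I s w ^+ 2 <= B) ->
  max_sqr L w <= B.
Proof.
move=> B0; elim: L => //= s L IH h; rewrite ge_max h ?mem_head// IH// => s' s'L.
by rewrite h// inE s'L orbT.
Qed.

Lemma max_sqr_measurable L : {in L, forall s, 0 <= s} -> measurable_fun setT (max_sqr L).
Proof.
elim: L => [|s L IH] h; first exact: measurable_cst.
apply: measurable_maxr; last by apply: IH => s' s'L; rewrite h// inE s'L orbT.
by apply: measurable_funX; apply: mI; rewrite h// mem_head.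
Qed.

(** Doob's inequality after localisation. Off a small event the cut-off maximum is compared with the
    running maximum of the martingale; the mean of its bracket is at most [(1 + e) B + e + N r],
    since the bracket is still at most [N] on that event. Letting [e] tend to 0 leaves [4 B] for
    every [m]. *)
Lemma max_sqr_bound (t B : R) (Y : T -> R) (L : seq R) : 0 <= t ->
  {in L, forall s, 0 <= s <= t} ->
  measurable_fun setT Y -> (forall w, 0 <= Y w) ->
  {ae P, forall w, (\int[leb]_(u in `[0%R, t]) ((H u w) ^+ 2)%:E <= (Y w)%:E)%E} ->
  (\int[P]_w (Y w)%:E <= B%:E)%E ->
  (\int[P]_w (max_sqr L w)%:E <= (4 * B)%:E)%E.
Proof.
move=> t0 Lt mY Y0 HY YB.
have YL : L1 P Y.
  apply/integrableP; split; first exact/measurable_EFinP.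
  under eq_integral do rewrite /= ger0_norm//.
  by rewrite (le_lt_trans YB)// ltry.
have YB' : Ex P Y <= B by rewrite -lee_fin Ex_EFin.
have B0 : 0 <= B by apply: le_trans YB'; exact: Rintegral_ge0.
have mX : measurable_fun setT (max_sqr L).
  by apply: max_sqr_measurable => s /Lt /andP[].
apply: (integral_le_cutoff mX (max_sqr_ge0 L) mY) => m.
(* Expand [4 (1 + e) ((1 + e) B + 2 e) + e^2 + 2 e] and use [e^2 <= e]: the excess over [4 B] is at
   most [(8 + 4) B e + (8 + 8 + 1 + 2) e]. *)
apply: (@le_eps_scale _ _ _ (12 * B + 19)); first by rewrite addr_ge0// mulr_ge0.
move=> e e0 e1.
set N : R := 2 * m%:R + 1.
have m0 : 0 <= m%:R :> R by [].
have N0 : 0 <= N by rewrite addr_ge0// mulr_ge0.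
pose r := e / (N + m%:R + 1).
have d0 : 0 < N + m%:R + 1 by rewrite ltr_wpDl// addr_ge0.
have r0 : 0 < r by rewrite divr_gt0.
have rd : r * (N + m%:R + 1) = e by rewrite /r divfK// gt_eqF.
have [p [n [v A]]] := martingale_approximation_exists HW mH HI t0 N0 e0 r0 Lt.
have [E [mE PE hE]] := holds_off_and (approx_off A) (holds_off_ae HY).
have [g vF [C vC] br _] := A; have [p0 pn nd] := g.
have p00 : 0 <= p 0%N by rewrite p0.
have D0 i : 0 <= p i.+1 - p i by rewrite subr_ge0.
have dd := dsum_doob HW p00 nd vF vC n.
have MML := mmax_L2 HW p00 nd vF vC n.
have PE' : Ex P (\1_E) <= r.
  by rewrite -lee_fin Ex_indic// (le_trans PE)// lee_fin !addr0.
have iE k := L1_scale k (L1_indic P mE).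
pose Q w := \sum_(i < n) v i w ^+ 2 * (p i.+1 - p i).
have Q0 w : 0 <= Q w by apply: sumr_ge0 => i _; rewrite mulr_ge0 ?sqr_ge0.
have iQ : L1 P Q.
  apply: (L1_le _ _ (L1_cst P N)).
    apply: (@measurable_fun_sumr _ _ _ _ _ (fun i w => v i w ^+ 2 * (p i.+1 - p i))) => i.
    apply: measurable_funM => //; apply: measurable_funX.
    exact: (measurable_wrt_measurable HW (vF i)).
  by move=> w; rewrite ger0_norm//; exact: br.
have EQ : Ex P Q <= (1 + e) * B + e + N * r.
  have i1 : L1 P (fun w => (1 + e) * Y w + e) by apply: L1_add; [exact: L1_scale|exact: L1_cst].
  apply: (@le_trans _ _ (Ex P (fun w => ((1 + e) * Y w + e) + N * \1_E w))).
    apply: Ex_le => //; first exact: (L1_add i1 (iE N)).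
    move=> w; rewrite indicE; have [wE|wE] := boolP (w \in E).
      rewrite mulr1; apply: (le_trans (br w)); rewrite lerDr addr_ge0// ?mulr_ge0// ?ltW//.
      by rewrite addr_gt0.
    have [[A1 _ _] Yw] := hE w (fun h => negP wE (mem_set h)).
    by rewrite mulr0 addr0; exact: A1.
  rewrite (Ex_add i1 (iE N)) (Ex_add (L1_scale _ YL) (L1_cst P e)) (Ex_scale _ YL).
  rewrite (Ex_scale _ (L1_indic P mE)) Ex_cst.
  rewrite lerD// ?lerD2r ler_wpM2l// addr_ge0// ltW//.
pose Z w := mmax W p v n w ^+ 2.
have iZ : L1 P Z by exact: MML.2.
have i2 : L1 P (fun w => (1 + e) * Z w + (e ^+ 2 + e)).
  by apply: L1_add; [exact: L1_scale|exact: L1_cst].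
apply: (@le_trans _ _ (Ex P (fun w => ((1 + e) * Z w + (e ^+ 2 + e)) + m%:R * \1_E w))).
  apply: Ex_le; [exact: (cutoff_L1 mX (max_sqr_ge0 L) mY)|exact: (L1_add i2 (iE _))|].
  move=> w.
  have R0 : 0 <= (1 + e) * Z w + (e ^+ 2 + e).
    apply: addr_ge0; last by apply: addr_ge0; [exact: sqr_ge0|exact: ltW].
    by apply: mulr_ge0; [apply: addr_ge0 => //; exact: ltW|exact: sqr_ge0].
  rewrite indicE; have [wE|wE] := boolP (w \in E).
    rewrite mulr1; apply: (le_trans (cutoff_le _ _ _ _)); by rewrite lerDr.
  rewrite mulr0 addr0 /cutoff; case: ifPn => [Ym|//].
  have [[_ A2 _] Yw] := hE w (fun h => negP wE (mem_set h)).
  rewrite ge_min; apply/orP; left; apply: max_sqr_le => // s sL.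
  have [|j jn [_ js]] := A2 (Y w) Yw (bracket_le_nat e0 e1 Ym (Y0 w)) s.
    by rewrite inE sL orbT.
  have mj := running_max_ge (fun j => dsum W p v j w) jn.
  rewrite /Z /mmax; move: (running_max _ _) mj => x mj.
  have Is : `|I s w| <= x + e.
    by have := ler_distD (dsum W p v j w) (I s w) 0; rewrite !subr0 distrC; lra.
  have x0 : 0 <= x by exact: le_trans (normr_ge0 _) mj.
  apply: (@le_trans _ _ ((x + e) ^+ 2)).
    rewrite -(real_normK (num_real (I s w))) lerXn2r ?nnegrE// addr_ge0// ltW//.
  rewrite -subr_ge0.
  have -> : (1 + e) * x ^+ 2 + (e ^+ 2 + e) - (x + e) ^+ 2 = e * (x - 1) ^+ 2 by ring.
  by rewrite mulr_ge0 ?sqr_ge0// ltW.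
rewrite (Ex_add i2 (iE _)) (Ex_add (L1_scale _ iZ) (L1_cst P _)) (Ex_scale _ iZ).
rewrite (Ex_scale _ (L1_indic P mE)) Ex_cst.
have ep : 0 <= 1 + e by rewrite addr_ge0// ltW.
have h1 : (1 + e) * Ex P Z <= (1 + e) * (4 * ((1 + e) * B + e + N * r)).
  apply: ler_wpM2l => //; apply: (le_trans dd); exact: ler_wpM2l.
have h2 : m%:R * Ex P (\1_E) <= m%:R * r by rewrite ler_wpM2l.
have h3 : N * r + m%:R * r <= e.
  by rewrite -rd -mulrDl mulrC ler_wpM2l ?lerDl// ltW.
have h4 : N * r <= e.
  by apply: le_trans h3; rewrite lerDl mulr_ge0// ltW.
have h5 : 0 <= N * r by rewrite mulr_ge0// ltW.
have h6 : 0 <= m%:R * r by rewrite mulr_ge0// ltW.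
apply: (@le_trans _ _ ((1 + e) * (4 * ((1 + e) * B + e + e)) + (e ^+ 2 + e) + e)).
  have : (1 + e) * (4 * ((1 + e) * B + e + N * r)) <= (1 + e) * (4 * ((1 + e) * B + e + e)).
    by apply: ler_wpM2l => //; apply: ler_wpM2l => //; rewrite lerD2l.
  by lra.
have ee : e ^+ 2 <= e by rewrite expr2 -[leRHS]mulr1 ler_wpM2l// ltW.
have eB : e ^+ 2 * B <= e * B by rewrite ler_wpM2r.
by nra.
Qed.

End estimates.

(** * Riemann sums of paths *)

Section riemann.
Context {R : realType}.
Implicit Types (f G : R -> R) (t : R).

Lemma heine_itv f t : continuous f -> forall e, 0 < e ->
  exists2 r, 0 < r & forall y z, 0 <= y <= t -> `|y - z| < r -> `|f y - f z| < e.
Proof.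
move=> cf e e0.
pose Q (r : R) (y : R) := forall z, `|y - z| < r -> `|f y - f z| < e.
have : \forall r \near 0^'+, `[0, t]%classic `<=` Q r.
  apply: (compact_near_coveringP _).1; first exact: segment_compact.
  move=> y _.
  have e2 : 0 < e / 2 by rewrite divr_gt0.
  have /cvgrPdist_lt /(_ _ e2) := cf y.
  move=> /nbhs_ballP[r /= r0 hr].
  have r2 : 0 < r / 2 by rewrite divr_gt0.
  exists (ball y (r / 2), [set s : R | s < r / 2]) => /=.
    split; first exact: nbhsx_ballx.
    exact: nbhs_right_lt.
  move=> [y' s] /= [yy' sr] z y'z.
  have h1 : `|f y - f y'| < e / 2.
    by apply: hr; apply: (lt_trans yy'); rewrite ltr_pdivrMr// ltr_pMr// ltr1n.
  have h2 : `|f y - f z| < e / 2.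
    apply: hr; rewrite /ball/= (le_lt_trans (ler_distD y' _ _))// (splitr r) ltrD//.
    exact: lt_trans y'z sr.
  rewrite (le_lt_trans (ler_distD (f y) _ _))// (splitr e) ltrD//.
  by rewrite distrC.
move=> h.
have hh : \forall r \near (0 : R)^'+, `[0, t]%classic `<=` Q r /\ 0 < r.
  by near=> r; split; near: r; [exact: h|exact: nbhs_right_gt].
have [r [hr r0]] := @filter_ex _ _ (at_right_proper_filter (0 : R)) _ hh.
by exists r => // y z yt yz; apply: hr => //=.
Unshelve. all: by end_near. Qed.

Definition uniform_point t (k j : nat) : R := t * j%:R / k.+1%:R.

Lemma uniform_point_itv t k j : 0 <= t -> (j <= k.+1)%N -> 0 <= uniform_point t k j <= t.
Proof.
move=> t0 jk; rewrite /uniform_point divr_ge0 ?mulr_ge0//=.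
by rewrite ler_pdivrMr// ler_wpM2l// ler_nat.
Qed.

(** On each cell the mean value theorem gives the increment of [G] as [f] at an intermediate point
    times the length; uniform continuity moves that point to the left end. The derivative is asked
    in the open interval only, as for the integral of a path starting at 0. *)
Lemma riemann_sum_cvg f G t : 0 <= t -> continuous f ->
  {within `[0, t], continuous G} ->
  (forall s : R, 0 < s -> s < t -> is_derive s (1 : R) G (f s)) ->
  (\sum_(j < k.+1) t / k.+1%:R * f (uniform_point t k j)) @[k --> \oo] --> G t - G 0.
Proof.
move=> t0 cf cG dG; apply/cvgrPdist_le => e e0.
(* The denominator [t + 1] in place of [t] also covers [t = 0]. *)
have e' : 0 < e / (t + 1) by rewrite divr_gt0// ltr_wpDl.
have [r r0 hr] := heine_itv t cf e'.
near=> k.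
have kr : t / k.+1%:R < r.
  rewrite ltr_pdivrMr// mulrC -ltr_pdivrMr//.
  near: k; exists (Num.bound (t / r)) => // n /= hn.
  apply: (lt_le_trans (archi_boundP _)); first by rewrite divr_ge0// ltW.
  by rewrite ler_nat (leq_trans hn).
pose s j := uniform_point t k j.
have sS j : s j.+1 - s j = t / k.+1%:R.
  by rewrite /s /uniform_point -mulrBl -mulrBr -natrB// subSnn mulr1.
have tk0 : 0 <= t / k.+1%:R by rewrite divr_ge0.
have slt j : s j <= s j.+1 by rewrite -subr_ge0 sS.
have st j : (j <= k.+1)%N -> 0 <= s j <= t by exact: uniform_point_itv.
have /choice[c hc] : forall j, exists c, (j < k.+1)%N ->
    s j <= c <= s j.+1 /\ G (s j.+1) - G (s j) = f c * (t / k.+1%:R).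
  move=> j.
  have [jk|_] := boolP (j < k.+1)%N; last by exists 0.
  have /andP[sj0 sjt] := st j (ltnW jk); have /andP[sj0' sjt'] := st _ jk.
  have [||c] := @MVT_segment R G f _ _ (slt j) _.
  - move=> z; rewrite in_itv/= => /andP[z1 z2]; apply: dG.
      exact: le_lt_trans z1.
    exact: lt_le_trans sjt'.
  - apply: continuous_subspaceW cG => z /=; rewrite !in_itv/= => /andP[z1 z2].
    by rewrite (le_trans sj0)//= (le_trans z2).
  by rewrite in_itv/= sS => h1 h2; exists c.
have GE : G t - G 0 = \sum_(j < k.+1) t / k.+1%:R * f (c j).
  have -> : G t - G 0 = G (s k.+1) - G (s 0%N).
    by rewrite /s /uniform_point mulr0 mul0r mulfK.
  rewrite -(telescope_sumr (fun j => G (s j)))// big_mkord; apply: eq_bigr => j _.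
  by have [_ ->] := hc j (ltn_ord j); rewrite mulrC.
rewrite GE -sumrB.
apply: (le_trans (ler_norm_sum _ _ _)).
apply: (@le_trans _ _ (\sum_(j < k.+1) t / k.+1%:R * (e / (t + 1)))).
  apply: ler_sum => j _; rewrite -mulrBr normrM ger0_norm// ler_wpM2l// distrC.
  have [/andP[h1 h2] _] := hc j (ltn_ord j).
  apply/ltW/hr; first by apply: st; exact: ltnW.
  rewrite distrC ger0_norm ?subr_ge0//; apply: le_lt_trans kr.
  by rewrite -(sS j) lerD2r.
have t1 : 0 < t + 1 by rewrite ltr_wpDl.
rewrite sumr_const card_ord -[leLHS]mulr_natr.
have -> : t / k.+1%:R * (e / (t + 1)) * k.+1%:R = e * (t / (t + 1)).
  by field; rewrite (gt_eqF t1)/=.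
apply: ler_piMr; first exact: ltW.
by rewrite ler_pdivrMr// mul1r lerDl.
Unshelve. all: by end_near. Qed.

(* Paths are only continuous on [[0, +oo[]; clamping extends them to the line. *)
Lemma clamp_continuous (f : R -> R) : {within `[0, +oo[, continuous f} ->
  continuous (fun s : R => f (Num.max s 0)).
Proof.
move=> cf s.
have D0 : `[0, +oo[%classic (Num.max s 0) by rewrite /= in_itv/= andbT le_max lexx orbT.
have := (subspace_continuousP _ _).1 cf _ D0.
apply: cvg_comp => A /= hA.
have : \forall z \near s, `[0, +oo[%classic (Num.max z 0) -> A (Num.max z 0).
  have cm : {for s, continuous (fun s : R => Num.max s 0)}.
    apply: (@continuous_max _ _ (fun s : R => s) (fun=> 0)); first exact: cvg_id.
    exact: cvg_cst.
  exact: cm hA.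
apply: filterS => z; apply; by rewrite /= in_itv/= andbT le_max lexx orbT.
Qed.

End riemann.

(** * Deterministic analysis of a single path *)

Section path.
Context {R : realType}.
Local Notation leb := (@lebesgue_measure R).
Variables (x i : R -> R) (x0 a b sigma : R).
Hypotheses (cx : {within `[0, +oo[, continuous x})
  (ci : {within `[0, +oo[, continuous i}) (xge0 : forall s, 0 <= s -> 0 <= x s)
  (eqx : forall t : R, 0 <= t ->
     x t = x0 + \int[leb]_(s in `[0, t]) (a - b * x s) + sigma * i t).

Let Y (t : R) : R := \int[leb]_(s in `[0, t]) x s.

Let sub t : `[0, t]%classic `<=` `[(0 : R), +oo[%classic.
Proof. by move=> s /=; rewrite !in_itv/= => /andP[->]. Qed.

Let cxt t : {within `[0, t], continuous x}.
Proof. exact: continuous_subspaceW (@sub t) cx. Qed.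

Let ix t : leb.-integrable `[0, t] (EFin \o x).
Proof. by apply: continuous_compact_integrable; [exact: segment_compact|exact: cxt]. Qed.

Lemma path_measurable (t : R) : measurable_fun `[0, t]%classic (fun s => Num.sqrt (x s)).
Proof.
apply: (measurableT_comp (continuous_measurable_fun (@sqrt_continuous R))).
by apply: subspace_continuous_measurable_fun; [exact: measurable_itv|exact: cxt].
Qed.

Lemma path_eq (t : R) : 0 <= t -> x t + b * Y t = x0 + a * t + sigma * i t.
Proof.
move=> t0; rewrite {1}(eqx t0).
have mt : measurable `[0, t]%classic by exact: measurable_itv.
have ibx : leb.-integrable `[0, t] (EFin \o (fun s => b * x s)).
  by have := @integrableZl _ _ _ leb _ mt b _ (ix t).
have ia : leb.-integrable `[0, t] (EFin \o (fun=> a)).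
  apply: continuous_compact_integrable; first exact: segment_compact.
  exact/continuous_subspaceT/cst_continuous.
rewrite RintegralB//.
rewrite RintegralZl//.
rewrite Rintegral_cst//.
have -> : fine (leb `[0, t]%classic) = t.
  rewrite lebesgue_measure_itv/= lte_fin; case: ltP => h; first by rewrite oppr0 addr0.
  by apply/eqP; rewrite eq_le t0 h.
by rewrite /Y; ring.
Qed.

Lemma path_integral_ge0 t : 0 <= Y t.
Proof. by apply: Rintegral_ge0 => s /=; rewrite in_itv/= => /andP[/xge0]. Qed.

Lemma path_integral_sqrt (t : R) :
  (\int[leb]_(s in `[0%R, t]) ((Num.sqrt (x s)) ^+ 2)%:E = (Y t)%:E)%E.
Proof.
rewrite /Y /Rintegral fineK; last exact: (integrable_fin_num _ (ix t)).
apply: eq_integral => s; rewrite inE/= in_itv/= => /andP[s0 _].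
by rewrite sqr_sqrtr// xge0.
Qed.

Let xc s := x (Num.max s 0).
Let ic s := i (Num.max s 0).
Let cxc : continuous xc. Proof. exact: clamp_continuous. Qed.
Let cic : continuous ic. Proof. exact: clamp_continuous. Qed.

Let clampE (s : R) : 0 <= s -> Num.max s 0 = s.
Proof. by move=> s0; apply/max_idPl. Qed.

Let YE (t : R) : Y t = \int[leb]_(s in `[0, t]) xc s.
Proof.
by apply: eq_Rintegral => s; rewrite inE/= in_itv/= => /andP[s0 _]; rewrite /xc clampE.
Qed.

Let ixc t : leb.-integrable `[0, t] (EFin \o xc).
Proof.
apply: continuous_compact_integrable; first exact: segment_compact.
exact: continuous_subspaceT.
Qed.

Let Y_deriv (t : R) : 0 < t -> is_derive t (1 : R) Y (x t).
Proof.
move=> t0.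
have tt : t < t + 1 by rewrite ltrDl.
have [d1 d2] := @continuous_FTC1_closed R xc 0 t (t + 1) tt (ixc _) t0 (@cxc t).
have -> : Y = (fun t => \int[leb]_(s in `[0, t]) xc s) by apply/funext => s; exact: YE.
by split => //; rewrite -derive1E d2 /xc clampE// ltW.
Qed.

Let Y_cont (t : R) : 0 <= t -> {within `[0, t], continuous Y}.
Proof.
move=> t0; have -> : Y = (fun s => \int[leb]_(u in `[0, s]) xc u).
  by apply/funext => s; exact: YE.
exact: (parameterized_integral_continuous t0 (ixc t)).
Qed.

(** The integrating factor [e^(b s)] solves [Y' + b Y = x0 + a s + sigma i] for [Y]. The sums
    involve [x] only through the combinations [x + b Y], with nonnegative weights when [t >= 0], so
    bounds on the means of these carry over to [Y]. *)
Lemma path_riemann (t : R) : 0 <= t ->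
  (expR (- (b * t)) * \sum_(j < k.+1) t / k.+1%:R *
    (expR (b * uniform_point t k j) * (x0 + a * uniform_point t k j + sigma * i (uniform_point t k j))))
    @[k --> \oo] --> Y t.
Proof.
move=> t0.
pose f s := expR (b * s) * (x0 + a * s + sigma * ic s).
pose G s := expR (b * s) * Y s.
have ce : continuous (fun s : R => expR (b * s)).
  move=> s; apply: (@continuous_comp _ _ _ (fun s : R => b * s) expR).
    by apply: cvgM; [exact: cvg_cst|exact: cvg_id].
  exact: continuous_expR.
have cf : continuous f.
  move=> s; apply: cvgM; first exact: ce.
  apply: cvgD; first apply: cvgD; first exact: cvg_cst.
    by apply: cvgM; [exact: cvg_cst|exact: cvg_id].
  by apply: cvgM; [exact: cvg_cst|exact: cic].
have cG : {within `[0, t], continuous G}.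
  move=> s; apply: cvgM; last exact: Y_cont.
  exact: (continuous_subspaceT ce).
have dG (s : R) : 0 < s -> s < t -> is_derive s (1 : R) G (f s).
  move=> s0 _; have Yd := Y_deriv s0.
  have de : is_derive s (1 : R) (fun s : R => expR (b * s)) (b * expR (b * s)).
    apply: is_derive_eq; rewrite /GRing.scale/=; ring.
  apply: is_derive_eq; rewrite /GRing.scale/= /f /ic clampE ?ltW//.
  by rewrite -(path_eq (ltW s0)); ring.
have := riemann_sum_cvg t0 cf cG dG.
have -> : G t - G 0 = expR (b * t) * Y t.
  by rewrite /G /Y set_itv1 Rintegral_set1 mulr0 subr0.
move=> h.
have {h} := cvgM (@cvg_cst _ (expR (- (b * t))) _ (\oo : set_system nat) _) h.
rewrite mulrA -expRD addNr expR0 mul1r => h.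
set u := (X in X @ \oo --> _).
suff -> : u = (fun k => expR (- (b * t)) * (\sum_(j < k.+1) t / k.+1%:R * f (uniform_point t k j))).
  exact: h.
apply/funext => k; rewrite /u; congr (_ * _).
apply: eq_bigr => j _; rewrite /f /ic clampE//.
by have /andP[] := uniform_point_itv t0 (ltnW (ltn_ord j) : (j <= k.+1)%N).
Qed.
End path.

Section mean_path.
Context {R : realType}.
Variables (x0 a b : R).
Hypothesis b0 : 0 < b.

(** The solution of [y' + b y = x0 + a t] with [y(0) = 0], the equation of [Y] with its martingale
    term removed. *)
Definition mean_integral (t : R) : R := (x0 - a / b) * (1 - expR (- (b * t))) / b + a / b * t.

Lemma mean_riemann t : 0 <= t ->
  (expR (- (b * t)) * \sum_(j < k.+1) t / k.+1%:R *
    (expR (b * uniform_point t k j) * (x0 + a * uniform_point t k j)))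
    @[k --> \oo] --> mean_integral t.
Proof.
move=> t0.
pose f s := expR (b * s) * (x0 + a * s).
pose G s := expR (b * s) * (x0 / b + a / b * s - a / b / b).
have ce : continuous (fun s : R => expR (b * s)).
  move=> s; apply: (@continuous_comp _ _ _ (fun s : R => b * s) expR).
    by apply: cvgM; [exact: cvg_cst|exact: cvg_id].
  exact: continuous_expR.
have cf : continuous f.
  move=> s; apply: cvgM; first exact: ce.
  apply: cvgD; first exact: cvg_cst.
  by apply: cvgM; [exact: cvg_cst|exact: cvg_id].
have dG (s : R) : is_derive s (1 : R) G (f s).
  apply: is_derive_eq; rewrite /GRing.scale/= /f; field; exact: lt0r_neq0.
have cG : {within `[0, t], continuous G}.
  by apply: continuous_subspaceT; exact: is_derive1_continuous dG.
have h := riemann_sum_cvg t0 cf cG (fun s _ _ => dG s).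
have {h} := cvgM (@cvg_cst _ (expR (- (b * t))) _ (\oo : set_system nat) _) h.
have -> : expR (- (b * t)) * (G t - G 0) = mean_integral t.
  have E : expR (- (b * t)) * expR (b * t) = 1 by rewrite -expRD addNr expR0.
  rewrite mulrBr {1}/G mulrA E /G /mean_integral !mulr0 expR0; field; exact: lt0r_neq0.
exact.
Qed.
End mean_path.

(** * The Cox-Ingersoll-Ross process *)

Section cir.
Context {d : measure_display} {T : measurableType d} {R : realType}.
Variables (P : probability T R) (W X I : R -> T -> R) (x0 a b sigma : R).
Hypotheses (x00 : 0 < x0) (a0 : 0 < a) (b0 : 0 < b) (sigma0 : 0 < sigma).
Hypothesis HW : wiener_process P W.
Hypotheses (adX : adapted (augmented_filtration P W) X) (cX : as_continuous P X)
  (X0 : {ae P, forall w, forall t : R, 0 <= t -> 0 <= X t w})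
  (HI : ito_integral_process P W (fun s w => Num.sqrt (X s w)) I)
  (eqX : {ae P, forall w, forall t : R, 0 <= t ->
      X t w = x0 + \int[lebesgue_measure]_(s in `[0, t]) (a - b * X s w)
              + sigma * I t w}).
Local Notation leb := (@lebesgue_measure R).

Definition good_path w := [/\ {within `[0, +oo[, continuous (X ^~ w)},
  {within `[0, +oo[, continuous (I ^~ w)}, forall t : R, 0 <= t -> 0 <= X t w &
  forall t : R, 0 <= t -> X t w = x0 + \int[leb]_(s in `[0, t]) (a - b * X s w) + sigma * I t w].

Lemma ae_good_path : {ae P, forall w, good_path w}.
Proof.
case: HI => _ cI _.
near=> w; split; near: w; [exact: cX|exact: cI|exact: X0|exact: eqX].
Unshelve. all: by end_near. Qed.

Let mI (t : R) : 0 <= t -> measurable_fun setT (I t).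
Proof.
by case: HI => adI _ _ t0; exact: (measurable_wrt_measurable HW (adI t t0)).
Qed.

Let mX (t : R) : 0 <= t -> measurable_fun setT (X t).
Proof. by move=> t0; exact: (measurable_wrt_measurable HW (adX t0)). Qed.

Let itoI (t : R) : 0 <= t -> ito_integral P W (fun s w => Num.sqrt (X s w)) t (I t).
Proof. by case: HI => _ _; exact. Qed.

Let mH : {ae P, forall w, forall t : R, 0 <= t ->
  measurable_fun `[0, t]%classic (fun s => Num.sqrt (X s w))}.
Proof. by apply: filterS ae_good_path => w [cx _ _ _] t _; exact: path_measurable. Qed.

(** A version of [X_t + b Y_t] that is measurable because [I t] is, and nonnegative also on bad
    paths. *)
Definition cir_total (t : R) (w : T) : R := Num.max (x0 + a * t + sigma * I t w) 0.

(** A version of [Y_t] obtained by solving the equation for it, so that its measurability in [w]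
    needs no joint measurability of [X]. *)
Definition cir_integral (t : R) (w : T) : R :=
  Num.max ((x0 + a * t + sigma * I t w - X t w) / b) 0.

Let good_eq w (t : R) : good_path w -> 0 <= t ->
  X t w + b * \int[leb]_(s in `[0, t]) X s w = x0 + a * t + sigma * I t w.
Proof.
move=> [cx _ _ eqx] t0; exact: (path_eq (x := X ^~ w) (i := I ^~ w) cx eqx t0).
Qed.

Let good_int_ge0 w (t : R) : good_path w -> 0 <= \int[leb]_(s in `[0, t]) X s w.
Proof. by move=> [_ _ xge0 _]; exact: (path_integral_ge0 (x := X ^~ w)). Qed.

Let good_total w (t : R) : good_path w -> 0 <= t ->
  cir_total t w = x0 + a * t + sigma * I t w.
Proof.
move=> gw t0; apply/max_idPl; rewrite -(good_eq gw t0).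
rewrite addr_ge0//; first by case: gw => _ _ + _; exact.
by rewrite mulr_ge0 ?(ltW b0)// good_int_ge0.
Qed.

Let good_integral w (t : R) : good_path w -> 0 <= t ->
  cir_integral t w = \int[leb]_(s in `[0, t]) X s w.
Proof.
move=> gw t0; rewrite /cir_integral -(good_eq gw t0).
rewrite (_ : _ / b = \int[leb]_(s in `[0, t]) X s w).
  by apply/max_idPl; exact: good_int_ge0.
by field; exact: lt0r_neq0.
Qed.

Let total_measurable (t : R) : 0 <= t -> measurable_fun setT (cir_total t).
Proof.
move=> t0; apply: measurable_maxr => //; apply: measurable_funD => //.
by apply: measurable_funM => //; exact: mI.
Qed.

Let integral_measurable (t : R) : 0 <= t -> measurable_fun setT (cir_integral t).
Proof.
move=> t0; apply: measurable_maxr => //; apply: measurable_funM => //.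
apply: measurable_funB; last exact: mX.
by apply: measurable_funD => //; apply: measurable_funM => //; exact: mI.
Qed.

Let total_ge0 t w : 0 <= cir_total t w.
Proof. by rewrite le_max lexx orbT. Qed.

Let integral_ge0 t w : 0 <= cir_integral t w.
Proof. by rewrite le_max lexx orbT. Qed.

Let bracket (t : R) : 0 <= t -> {ae P, forall w,
  (\int[leb]_(u in `[0%R, t]) ((Num.sqrt (X u w)) ^+ 2)%:E <= (cir_integral t w)%:E)%E}.
Proof.
move=> t0; apply: filterS ae_good_path => w gw.
rewrite (good_integral gw t0); case: gw => cx _ xge0 _.
by rewrite (path_integral_sqrt (x := X ^~ w) cx xge0).
Qed.

(** On good paths [x0 + a s + sigma I_s >= 0], so [I_s >= - c] for all [s <= t] with
    [c = (x0 + a t) / sigma]. Then [supermartingale_bound] applies, and multiplication by [sigma]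
    gives the claim. *)
Lemma cir_total_mean (t : R) : 0 <= t -> (\int[P]_w (cir_total t w)%:E <= (x0 + a * t)%:E)%E.
Proof.
move=> t0; pose c := (x0 + a * t) / sigma.
have at0 : 0 <= a * t by rewrite mulr_ge0// ltW.
have c0 : 0 <= c by rewrite divr_ge0 ?addr_ge0// ltW.
have low : {ae P, forall w, forall s, 0 <= s <= t -> - c <= I s w}.
  apply: filterS ae_good_path => w gw s /andP[s0 st].
  have := total_ge0 s w; rewrite (good_total gw s0) => h.
  rewrite lerNl /c ler_pdivlMr//.
  have : a * s <= a * t by rewrite ler_wpM2l// ltW.
  by lra.
have := supermartingale_bound HW mH itoI mI t0 c0 (integral_measurable t0)
  (integral_ge0 t) (bracket t0) low.
have -> : (\int[P]_w (cir_total t w)%:E =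
    \int[P]_w (sigma%:E * (Num.max (I t w + c) 0)%:E))%E.
  apply: eq_integral => w _; rewrite -EFinM maxr_pMr ?(ltW sigma0)// mulr0.
  rewrite /cir_total; congr ((Num.max _ _)%:E).
  by rewrite /c; field; exact: lt0r_neq0.
rewrite ge0_integralZl//; last 3 first.
- by apply/measurable_EFinP; apply: measurable_maxr => //; apply: measurable_funD => //; exact: mI.
- by move=> w _; rewrite lee_fin le_max lexx orbT.
- by rewrite lee_fin ltW.
move=> h; have -> : (x0 + a * t)%:E = (sigma%:E * c%:E)%E.
  by rewrite -EFinM /c; congr (_%:E); field; exact: lt0r_neq0.
by rewrite lee_wpmul2l// lee_fin ltW.
Qed.

Let total_L1 (t : R) : 0 <= t -> L1 P (cir_total t).
Proof.
move=> t0; apply/integrableP; split; first by apply/measurable_EFinP; exact: total_measurable.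
under eq_integral do rewrite /= ger0_norm//.
by apply: (le_lt_trans (cir_total_mean t0)); rewrite ltry.
Qed.

(* [Y_t] is a pathwise limit of Riemann sums whose means are known, so Fatou's
   lemma replaces Fubini's theorem and [X] need not be jointly measurable. *)
Lemma cir_integral_mean (t : R) : 0 <= t ->
  (\int[P]_w (cir_integral t w)%:E <= (mean_integral x0 a b t)%:E)%E.
Proof.
move=> t0; have [E [mE PE hE]] := ae_good_path.
have gE w : ~ E w -> good_path w by move=> Ew; apply: contrapT => gw; apply: Ew; exact: hE.
pose s k j := uniform_point t k j.
have s0 k (j : 'I_k.+1) : 0 <= s k j.
  by have /andP[] := uniform_point_itv t0 (ltnW (ltn_ord j) : (j <= k.+1)%N).
pose S k w := expR (- (b * t)) * \sum_(j < k.+1) t / k.+1%:R *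
    (expR (b * s k j) * cir_total (s k j) w).
pose y k := expR (- (b * t)) * \sum_(j < k.+1) t / k.+1%:R *
    (expR (b * s k j) * (x0 + a * s k j)).
have S0 k w : 0 <= S k w.
  rewrite mulr_ge0 ?expR_ge0//; apply: sumr_ge0 => j _.
  by rewrite mulr_ge0 ?divr_ge0// mulr_ge0// expR_ge0.
have SjL k (j : 'I_k.+1) : L1 P (fun w => t / k.+1%:R * (expR (b * s k j) * cir_total (s k j) w)).
  by apply: L1_scale; apply: L1_scale; exact: total_L1.
have sumL k : L1 P (fun w => \sum_(j < k.+1) t / k.+1%:R * (expR (b * s k j) * cir_total (s k j) w)).
  apply: (@L1_sum _ _ _ _ k.+1 (fun j w => t / k.+1%:R * (expR (b * s k j) * cir_total (s k j) w))).
  by move=> j jk; exact: (SjL k (Ordinal jk)).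
have SL k : L1 P (S k) by exact: L1_scale.
have Sy k : Ex P (S k) <= y k.
  rewrite /S (Ex_scale _ (sumL k)) ler_wpM2l ?expR_ge0//.
  rewrite (@Ex_sum _ _ _ _ k.+1 (fun j w => t / k.+1%:R * (expR (b * s k j) * cir_total (s k j) w))).
    apply: ler_sum => j _; rewrite Ex_scale; last by apply: L1_scale; exact: total_L1.
    rewrite Ex_scale; last exact: total_L1.
    rewrite ler_wpM2l ?divr_ge0// ler_wpM2l ?expR_ge0//.
    by rewrite -lee_fin Ex_EFin; [exact: cir_total_mean|exact: total_L1].
  by move=> j jk; exact: (SjL k (Ordinal jk)).
apply: (@le_trans _ _ (\int[P]_w (cir_integral t w * \1_(~` E) w)%:E)%E).
  apply: ae_ge0_le_integral_nonmeasurable.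
  - by move=> w; rewrite lee_fin.
  - by move=> w; rewrite lee_fin mulr_ge0.
  - apply/measurable_EFinP; apply: measurable_funM; first exact: integral_measurable.
    by apply: measurable_indic; exact: measurableC.
  - exists E; split => // w /= h; apply: contrapT => Ew; apply: h.
    by rewrite indicE mem_set// mulr1.
apply/lee_addgt0Pr => e e0.
(* Fatou is used with a bound common to all terms: dropping the first [K] sums brings every mean
   below the limit plus [e]. *)
have /cvgrPdist_le /(_ _ e0) [K _ hK] := @mean_riemann R x0 a b b0 t t0.
have yK n : y (n + K)%N <= mean_integral x0 a b t + e.
  have /= := hK (n + K)%N (leq_addl _ _).
  by rewrite -/(y (n + K)%N) ler_norml => /andP[h1 h2]; lra.
apply: (@fatou_bound _ _ _ P (fun n w => (S (n + K)%N w * \1_(~` E) w)%:E)).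
- move=> n; apply/measurable_EFinP; apply: measurable_funM; first exact: (L1_measurable (SL _)).
  by apply: measurable_indic; exact: measurableC.
- by move=> n w; rewrite lee_fin mulr_ge0.
- move=> n; apply: (@le_trans _ _ (\int[P]_w (S (n + K)%N w)%:E)%E); last first.
    by rewrite -Ex_EFin// lee_fin (le_trans (Sy _)).
  apply: ae_ge0_le_integral_nonmeasurable.
  + by move=> w; rewrite lee_fin mulr_ge0.
  + by move=> w; rewrite lee_fin.
  + by apply/measurable_EFinP; exact: (L1_measurable (SL _)).
  + apply: nearW => w; rewrite lee_fin indicE.
    by case: (_ \in _); rewrite ?mulr1 ?mulr0.
- move=> w; rewrite indicE; have [wE|wE] := boolP (w \in ~` E); last first.
    rewrite mulr0; under eq_fun do rewrite mulr0.
    exact: cvg_cst.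
  have {wE} gw : good_path w by apply: gE; move: wE; rewrite inE.
  rewrite mulr1; under eq_fun do rewrite mulr1.
  apply: cvg_EFin; first exact: nearW.
  rewrite (good_integral gw t0); case: (gw) => cx ci xge0 eqx.
  have h := path_riemann cx ci eqx t0.
  have : (S n w) @[n --> \oo] --> \int[leb]_(s in `[0, t]) X s w.
    set u := (X in X @ \oo --> _).
    suff -> : u = (fun k => expR (- (b * t)) * \sum_(j < k.+1) t / k.+1%:R *
      (expR (b * uniform_point t k j) * (x0 + a * uniform_point t k j + sigma * I (uniform_point t k j) w))).
      exact: h.
    apply/funext => k; rewrite /u /S; congr (_ * _); apply: eq_bigr => j _.
    by rewrite good_total.
  by rewrite -(cvg_shiftn K).
Qed.

(** Consecutive uniform grids are not nested, so these maxima need not increase with [k]; hence a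
    lower limit and Fatou in place of monotone convergence. *)
Lemma cir_integral_sqr_sup (t : R) : 0 <= t ->
  (\int[P]_w limn_einf (fun k => (max_sqr I [seq uniform_point t k j | j <- iota 0 k.+2] w)%:E)
     <= (4 * mean_integral x0 a b t)%:E)%E.
Proof.
move=> t0; set L := fun k => [seq uniform_point t k j | j <- iota 0 k.+2].
have Lt k : {in L k, forall s, 0 <= s <= t}.
  move=> s /mapP[j]; rewrite mem_iota/= add0n ltnS => jk ->.
  exact: uniform_point_itv.
have mL k : measurable_fun setT (max_sqr I (L k)).
  by apply: (max_sqr_measurable mI) => s /Lt /andP[].
have mLE k : measurable_fun setT (fun w => (max_sqr I (L k) w)%:E).
  by apply/measurable_EFinP; exact: mL.
have L0 k w : [set: T] w -> (0 <= (max_sqr I (L k) w)%:E)%E.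
  by rewrite lee_fin max_sqr_ge0.
apply: (le_trans (fatou P measurableT mLE L0)).
apply: limn_einf_le_bound => k.
exact: (max_sqr_bound HW mH itoI mI t0 (Lt k) (integral_measurable t0)
  (integral_ge0 t) (bracket t0) (cir_integral_mean t0)).
Qed.

(** Every grid has a point within [t / (k + 1)] of [s], and the path is uniformly continuous, so all
    but finitely many maxima exceed [I s w ^+ 2 - e]. The lower limit thus bounds the supremum over
    all times. *)
Lemma good_sup (t : R) w s : good_path w -> 0 <= s <= t ->
  (((I s w) ^+ 2)%:E <=
   limn_einf (fun k => (max_sqr I [seq uniform_point t k j | j <- iota 0 k.+2] w)%:E))%E.
Proof.
move=> [_ ci _ _] /andP[s0 st].
have t0 := le_trans s0 st.
set g := fun k => _.
have ci2 : continuous (fun u : R => I (Num.max u 0) w ^+ 2).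
  move=> u; apply: (@continuous_comp _ _ _ (fun u : R => I (Num.max u 0) w) (fun z => z ^+ 2)).
    exact: (clamp_continuous ci).
  exact: sqr_continuous.
apply/lee_subgt0Pr => e e0; rewrite -EFinB.
have [r r0 hr] := heine_itv t ci2 e0.
have [K hK] : exists K, forall k, (K <= k)%N -> ((I s w ^+ 2 - e)%:E <= g k)%E.
  exists (Num.bound (t / r)) => k kK.
  have kr : t / k.+1%:R < r.
    rewrite ltr_pdivrMr// mulrC -ltr_pdivrMr//.
    apply: (lt_le_trans (archi_boundP _)); first by rewrite divr_ge0// ltW.
    by rewrite ler_nat (leq_trans kK).
  have [j jk js] : exists2 j, (j <= k.+1)%N & `|s - uniform_point t k j| < r.
    have k0 : 0 < k.+1%:R :> R by [].
    have [t00|tpos] : t = 0 \/ 0 < t.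
      by move: t0; rewrite le_eqVlt => /predU1P[->|]; [left|right].
      exists 0%N => //; rewrite /uniform_point mulr0 mul0r subr0 ger0_norm//.
      by rewrite (le_lt_trans st)// t00.
    (* The index of the last grid point at or before [s]; the division by [t] is why [t = 0] was
       treated apart. *)
    pose j := Num.trunc (s * k.+1%:R / t).
    have q0 : 0 <= s * k.+1%:R / t by rewrite divr_ge0// mulr_ge0.
    have /andP[j1 j2] := Num.Theory.truncn_itv q0.
    have jt : uniform_point t k j <= s.
      by move: j1; rewrite -/j ler_pdivlMr// /uniform_point ler_pdivrMr// mulrC.
    have jk : (j <= k.+1)%N.
      rewrite -(ler_nat R) (le_trans j1)// ler_pdivrMr// mulrC ler_wpM2l//.
    exists j => //; rewrite ger0_norm ?subr_ge0//; apply: le_lt_trans kr.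
    rewrite lerBlDr /uniform_point -mulrDl ler_pdivlMr//.
    move: j2; rewrite -/j ltr_pdivrMr// => /ltW; rewrite -natr1; lra.
  have := hr s (uniform_point t k j); rewrite s0 st => /(_ isT js).
  have /andP[u0 _] := uniform_point_itv t0 jk.
  rewrite (max_idPl s0) (max_idPl u0) ltr_norml => /andP[_ h2].
  rewrite /g lee_fin; apply: (@le_trans _ _ (I (uniform_point t k j) w ^+ 2)).
    lra.
  by apply: max_sqr_ge; apply/mapP; exists j => //; rewrite mem_iota/= add0n ltnS.
rewrite limn_einf_lim; apply: (@le_trans _ _ (einfs g K)).
  by apply: le_ereal_inf_tmp => _ [n /= Kn <-]; exact: hK.
rewrite (cvg_lim _ (@cvg_einfs_sup _ g))//.
by apply: ereal_sup_ubound; exists K.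
Qed.

(** The supremum may fail to be measurable, so it is dominated almost surely by the measurable
    [c1 + c2 * G], using [(u + z)^2 <= 2 u^2 + 2 z^2] and the monotonicity of [x0 + a s] in [s]. *)
Lemma cir_sup_bound (t : R) : 0 <= t ->
  (\int[P]_w ereal_sup
      [set ((X s w + b * (\int[leb]_(u in `[0%R, s]) X u w)%R) ^+ 2)%:E | s in `[0%R, t]]
   <= (2 * (x0 + a * t) ^+ 2 + 8 * sigma ^+ 2 * mean_integral x0 a b t)%:E)%E.
Proof.
move=> t0.
pose G w := limn_einf (fun k => (max_sqr I [seq uniform_point t k j | j <- iota 0 k.+2] w)%:E).
have mG : measurable_fun setT G.
  apply: (emeasurable_fun_cvg (fun n w => einfs (fun k =>
      (max_sqr I [seq uniform_point t k j | j <- iota 0 k.+2] w)%:E) n)); last first.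
    by move=> w _; rewrite /G limn_einf_lim; exact: is_cvg_einfs.
  apply: measurable_fun_einfs => k; apply/measurable_EFinP.
  apply: (max_sqr_measurable mI) => s /mapP[j]; rewrite mem_iota/= add0n ltnS => jk ->.
  by have /andP[] := uniform_point_itv t0 jk.
have G0 w : (0 <= G w)%E.
  rewrite /G limn_einf_lim; apply: lime_ge; first exact: is_cvg_einfs.
  apply: nearW => n; apply: le_ereal_inf_tmp => _ [m _ <-].
  by rewrite lee_fin max_sqr_ge0.
pose c1 := 2 * (x0 + a * t) ^+ 2; pose c2 := 2 * sigma ^+ 2.
have c10 : 0 <= c1 by rewrite mulr_ge0// sqr_ge0.
have c20 : 0 <= c2 by rewrite mulr_ge0// sqr_ge0.
apply: (@le_trans _ _ (\int[P]_w (c1%:E + c2%:E * G w))%E).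
  apply: ae_ge0_le_integral_nonmeasurable.
  - move=> w; apply: (@le_trans _ _ (((X t w + b * (\int[leb]_(u in `[0%R, t]) X u w)%R) ^+ 2)%:E)).
      by rewrite lee_fin sqr_ge0.
    by apply: ereal_sup_ubound; exists t => //=; rewrite in_itv/= t0 lexx.
  - by move=> w; rewrite adde_ge0// mule_ge0.
  - by apply: emeasurable_funD => //; exact: measurable_funeM.
  apply: filterS ae_good_path => w gw.
  apply: ge_ereal_sup => z [s /=]; rewrite in_itv/= => /andP[s0 st] <-{z}.
  rewrite (good_eq gw s0).
  have sG : (((I s w) ^+ 2)%:E <= G w)%E by apply: good_sup => //; rewrite s0.
  apply: (@le_trans _ _ (c1%:E + c2%:E * ((I s w) ^+ 2)%:E)%E); last first.
    by rewrite leeD2l// lee_wpmul2l.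
  rewrite -EFinM -EFinD lee_fin /c1 /c2.
  have h1 : (x0 + a * s) ^+ 2 <= (x0 + a * t) ^+ 2.
    rewrite lerXn2r ?nnegrE ?addr_ge0 ?mulr_ge0 ?(ltW a0) ?(ltW x00)//.
    by rewrite lerD2l ler_wpM2l// ltW.
  have := sqr_ge0 (x0 + a * s - sigma * I s w).
  move: (x0 + a * s) ((x0 + a * t) ^+ 2) h1 => u v uv.
  move: (I s w) => z; nra.
rewrite ge0_integralD//; last 2 first.
- by move=> w _; rewrite mule_ge0.
- exact: measurable_funeM.
rewrite ge0_integralZl// integral_cst//= probability_setT mule1.
have -> : 2 * (x0 + a * t) ^+ 2 + 8 * sigma ^+ 2 * mean_integral x0 a b t =
  c1 + c2 * (4 * mean_integral x0 a b t) by rewrite /c1 /c2; ring.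
rewrite [leRHS]EFinD [X in (_ <= _ + X)%E]EFinM leeD2l// lee_wpmul2l//.
exact: cir_integral_sqr_sup.
Qed.
End cir.

Theorem proposition3p3 (d : measure_display) (T : measurableType d)
    (R : realType) (P : probability T R) (W X : R -> T -> R)
    (x0 a b sigma : R) :
  0 < x0 -> 0 < a -> 0 < b -> 0 < sigma -> sigma ^+ 2 <= 2 * a ->
  wiener_process P W ->
  cir_solution P W x0 a b sigma X ->
  forall t : R, 0 <= t ->
  (\int[P]_w ereal_sup
      [set ((X s w + b * (\int[lebesgue_measure]_(u in `[0%R, s]) X u w)%R)
              ^+ 2)%:E | s in `[0%R, t]]
   <= (2 * (x0 + a * t) ^+ 2
       + 8 * sigma ^+ 2 / b * (x0 - a / b) * (1 - expR (- (b * t)))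
       + 8 * sigma ^+ 2 * a / b * t)%:E)%E.
Proof.
move=> x00 a0 b0 sigma0 _ HW [adX cX X0 [I [HI eqX]]] t t0.
apply: (le_trans (cir_sup_bound x00 a0 b0 sigma0 HW adX cX X0 HI eqX t0)).
rewrite lee_fin le_eqVlt; apply/orP; left; apply/eqP.
by rewrite /mean_integral; field; exact: lt0r_neq0.
Qed.
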